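(* Let $\Omega=\{0,1\}^{\mathbb N}$ with the one-sided shift $\sigma:\Omega\to\Omega$. Suppose that $\mathbf a=(a_n)_{n\in\mathbb N}$ is an evanescent sequence and that $\mathbf b=(b_\omega)_{\omega\in\Omega^*}$ is an admissible gauge with respect to $\mathbf a$. Then for every $f_0\in C^{\mathbf a}(\Omega)$, $$\mathbb P_{\mathbf b}\big(\{g\in\mathcal H_{\mathbf b} : f_0+g\in\mathsf L_{\mathbf a}\}\big)=1 .$$
   Context: $\mathbb N$ includes $0$. $\sigma$ is the left shift on $\Omega=\{0,1\}^{\mathbb N}$ (product topology), and $\mathcal M_\sigma$ is the set of $\sigma$-invariant Borel probability measures on $\Omega$. A measure in $\mathcal M_\sigma$ is periodic if it is supported on a periodic orbit. Metric and function space. Let $\mathbf a=(a_n)_{n\in\mathbb N}$ be a strictly decreasing sequence of positive numbers converging to $0$ ($\mathbf a\searrow 0$). Define $d_{\mathbf a}(x,y)=a_m$, where $m$ is the least index with $x_m\ne y_m$, and $d_{\mathbf a}(x,x)=0$. $C^{\mathbf a}(\Omega)$ is the Banach space of $d_{\mathbf a}$-Lipschitz functions $f:\Omega\to\mathbb R$ with norm $\|f\|_\infty+\operatorname{Lip}_{\mathbf a}(f)$, $\operatorname{Lip}_{\mathbf a}(f)$ being the least Lipschitz constant with respect to $d_{\mathbf a}$. Evanescent: $\mathbf a\searrow 0$ and $a_{n+1}/a_n=O(2^{-2^{n+2}})$ as $n\to\infty$. Maximizing measure: $\mu\in\mathcal M_\sigma$ is maximizing for a continuous $f$ if $\int f\,d\mu=\sup_{\nu\in\mathcal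 M_\sigma}\int f\,d\nu$. Locking property: $f\in C^{\mathbf a}(\Omega)$ has it if it has a unique maximizing measure $\mu$, $\mu$ is periodic, and $\mu$ is the unique maximizing measure of every $\tilde f\in C^{\mathbf a}(\Omega)$ sufficiently close to $f$ in the norm of $C^{\mathbf a}(\Omega)$. $\mathsf L_{\mathbf a}$ is the set of functions in $C^{\mathbf a}(\Omega)$ with the locking property. Words and Haar functions. $\Omega^*$ is the set of finite words in the letters $0,1$ (including the empty word), $|\omega|$ is the length of $\omega$, and the cylinder $[\omega]$ is the set of elements of $\Omega$ having $\omega$ as initial subword. The Haar function of $\omega\in\Omega^*$ is $h_\omega=\tfrac12(\chi_{[\omega0]}-\chi_{[\omega1]})$. Gauges. A gauge is a family $\mathbf b=(b_\omega)_{\omega\in\Omega^*}$ of positive numbers. Put $\bar b_n=\max_{|\omega|=n}b_\omega$ and $\underline b_n=\min_{|\omega|=n}b_\omega$. The gauge is admissible with respect to $\mathbf a$ if $\bar b_n=o(a_n)$ and $\log(a_n/\underline b_n)=O(n)$ as $n\to\infty$. Hilbert brick and the measure $\mathbb P_{\mathbf b}$. $\mathcal H_{\mathbf b}=\{\sum_{\omega\in\Omega^*}c_\omega h_\omega : |c_\omega|\le b_\omega\ \forall\omega\}$, where the series is summed level by level, i.e. as $\sum_{n\ge0}\big(\sum_{|\omega|=n}c_\omega h_\omega\big)$, uniformly convergent. Under the stated hypotheses, $\mathcal H_{\mathbf b}$ is a compact subset of $C^{\mathbf a}(\Omega)$ and is identified with $\prod_{\omega\in\Omega^*}[-b_\omega,b_\omega]$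 via the coefficients $(c_\omega)$. $\mathbb P_{\mathbf b}$ is the Borel probability measure on $C^{\mathbf a}(\Omega)$, supported on $\mathcal H_{\mathbf b}$, corresponding under this identification to the product of the normalized Lebesgue measures on the intervals $[-b_\omega,b_\omega]$. *)

(* Defs.v *)
From HB Require Import structures.
From mathcomp Require Import all_boot all_order all_algebra.
From mathcomp Require Import all_classical all_reals all_analysis.
Import Order.TTheory GRing.Theory Num.Theory.
Import numFieldNormedType.Exports.

Set Implicit Arguments.
Unset Strict Implicit.
Unset Printing Implicit Defensive.

Local Open Scope classical_set_scope.
Local Open Scope ring_scope.

Notation borel T := (g_sigma_algebraType (@open T)).

(* The space Omega is the library's [cantor_space], that is [nat -> bool] with
   the product topology. *)
Definition shift (x : cantor_space) : cantor_space := fun n => x n.+1.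

Record scale (R : realType) := Scale {
  scale_val :> nat -> R ;
  scale_gt0 : forall n, 0 < scale_val n ;
  scale_decr : forall n, scale_val n.+1 < scale_val n ;
  scale_cvg0 : scale_val @ \oo --> 0 }.

Definition evanescent (R : realType) (a : scale R) : Prop :=
  (fun n => a n.+1 / a n : R^o) =O_\oo (fun n => (2 ^+ (2 ^ n.+2))^-1 : R^o).

Definition dist (R : realType) (a : scale R) (x y : cantor_space) : R :=
  match pselect (exists m, x m != y m) with
  | left xy => a (ex_minn xy)
  | right _ => 0
  end.

Definition lip_const (R : realType) (a : scale R) (f : cantor_space -> R) :
  set R := [set k | forall x y, `|f x - f y| <= k * dist a x y].

Definition lip_pred (R : realType) (a : scale R) :
  {pred (cantor_space -> R)} := mem [set f | lip_const a f !=set0].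

(* [lip a] is the space of the functions that are Lipschitz with respect to
   [dist a]; its normed module structure is given by [lip_norm]. *)
Record lip (R : realType) (a : scale R) := Lip {
  lip_val :> cantor_space -> R ;
  lipP : lip_val \in lip_pred a }.

Definition lip_norm (R : realType) (a : scale R) (f : cantor_space -> R) : R :=
  sup [set `|f x| | x in [set: cantor_space]] + inf (lip_const a f).

Section lip_space.
Context (R : realType) (a : scale R).

Lemma dist_ge0 x y : 0 <= dist a x y.
Proof. by rewrite /dist; case: pselect => // h; exact/ltW/scale_gt0. Qed.

Lemma dist_le x y : dist a x y <= a 0.
Proof.
rewrite /dist; case: pselect => [h|_]; last exact/ltW/scale_gt0.
elim: (ex_minn h) => // n; apply: le_trans; exact/ltW/scale_decr.
Qed.

Lemma dist_eq0 x y : dist a x y = 0 -> x = y.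
Proof.
rewrite /dist; case: pselect => [h h0|h _].
  by have := scale_gt0 a (ex_minn h); rewrite h0 ltxx.
apply/funext => n; apply/eqP; apply: contrapT => /negP xy.
by apply: h; exists n.
Qed.

Lemma dist_gt0_ex : exists x y, 0 < dist a x y.
Proof.
exists (fun=> true), (fun=> false); rewrite lt_neqAle dist_ge0 andbT eq_sym.
by apply/eqP => /dist_eq0/(congr1 (@^~ 0%N)).
Qed.

Lemma lip_const_ge0 (f : cantor_space -> R) k : lip_const a f k -> 0 <= k.
Proof.
move=> fk; have [x [y xy]] := dist_gt0_ex.
by rewrite -(pmulr_lge0 _ xy); apply: le_trans (fk x y).
Qed.

Lemma lip_const_inf (f : cantor_space -> R) : lip_const a f !=set0 ->
  lip_const a f (inf (lip_const a f)).
Proof.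
move=> f0 x y; have := dist_ge0 x y.
rewrite le_eqVlt => /predU1P[/esym xy|xy].
  by rewrite xy mulr0 (dist_eq0 xy) subrr normr0.
rewrite -ler_pdivrMr//; apply: lb_le_inf => // k fk.
by rewrite ler_pdivrMr.
Qed.

Lemma inf_lip_const_le (f : cantor_space -> R) k : lip_const a f k -> inf (lip_const a f) <= k.
Proof. by apply: ge_inf; exists 0 => l; exact: lip_const_ge0. Qed.

Lemma lip_constD (f g : cantor_space -> R) k l : lip_const a f k -> lip_const a g l ->
  lip_const a (f + g) (k + l).
Proof.
move=> fk gl x y; rewrite !fctE mulrDl opprD addrACA.
by rewrite (le_trans (ler_normD _ _))// lerD.
Qed.

Lemma lip_constZ (f : cantor_space -> R) k (c : R) : lip_const a f k ->
  lip_const a (c *: f) (`|c| * k).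
Proof.
move=> fk x y; rewrite !fctE /= -scalerBr normrM -mulrA.
by rewrite ler_wpM2l.
Qed.

Lemma lip_submod_closed : submod_closed (lip_pred a).
Proof.
split; first by rewrite inE; exists 0 => x y; rewrite mul0r subrr normr0.
move=> c f g; rewrite !inE => -[k fk] [l gl].
by exists (`|c| * k + l); apply: lip_constD => //; exact: lip_constZ.
Qed.

Lemma lip_bounded (f : cantor_space -> R) : lip_const a f !=set0 ->
  has_ubound [set `|f x| | x in [set: cantor_space]].
Proof.
move=> [k fk]; pose z : cantor_space := fun=> true.
exists (k * a 0 + `|f z|) => _ [x _ <-].
rewrite -lerBlDr (le_trans (lerB_dist _ _))// (le_trans (fk _ _))//.
by rewrite ler_wpM2l ?dist_le//; exact: lip_const_ge0 fk.
Qed.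

Lemma sup_norm_ge (f : cantor_space -> R) x : lip_const a f !=set0 ->
  `|f x| <= sup [set `|f x| | x in [set: cantor_space]].
Proof.
move=> f0; apply: sup_upper_bound; last by exists x.
by split; [exists `|f x|, x|exact: lip_bounded].
Qed.

Lemma sup_norm_le (f : cantor_space -> R) k : (forall x, `|f x| <= k) ->
  sup [set `|f x| | x in [set: cantor_space]] <= k.
Proof.
move=> fk; apply: ge_sup; last by move=> _ [x _ <-].
by exists `|f point|; exists point.
Qed.

Lemma lip_norm_ge0 (f : cantor_space -> R) : lip_const a f !=set0 -> 0 <= lip_norm a f.
Proof.
move=> f0; apply: addr_ge0; last exact: lip_const_ge0 (lip_const_inf f0).
exact: le_trans (sup_norm_ge point f0).
Qed.

Lemma lip_normZ_le (f : cantor_space -> R) (c : R) : lip_const a f !=set0 ->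
  lip_norm a (c *: f) <= `|c| * lip_norm a f.
Proof.
move=> f0; rewrite mulrDr; apply: lerD.
  apply: sup_norm_le => x; rewrite fctE normrM.
  by rewrite ler_wpM2l//; exact: sup_norm_ge.
by apply: inf_lip_const_le; apply: lip_constZ; exact: lip_const_inf.
Qed.

HB.instance Definition _ := GRing.isSubmodClosed.Build _ _ (lip_pred a)
  lip_submod_closed.
HB.instance Definition _ := [isSub for @lip_val R a].
HB.instance Definition _ := [Choice of lip a by <:].
HB.instance Definition _ := [SubChoice_isSubLmodule of lip a by <:].

Lemma lip_const_neq0 (f : lip a) : lip_const a f !=set0.
Proof. by have := lipP f; rewrite inE. Qed.

Lemma lip_normD (f g : lip a) :
  lip_norm a (f + g) <= lip_norm a f + lip_norm a g.
Proof.
rewrite addrACA; apply: lerD.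
  apply: sup_norm_le => x; rewrite (le_trans (ler_normD _ _))//.
  by apply: lerD; exact/sup_norm_ge/lip_const_neq0.
apply: inf_lip_const_le; apply: lip_constD; exact/lip_const_inf/lip_const_neq0.
Qed.

Lemma lip_normZ (c : R) (f : lip a) : lip_norm a (c *: f) = `|c| * lip_norm a f.
Proof.
have cf : lip_const a (c *: (f : cantor_space -> R)) !=set0.
  exact: (lip_const_neq0 (c *: f)).
apply/eqP; rewrite eq_le lip_normZ_le ?andTb; last exact: lip_const_neq0.
have [->|c0] := eqVneq c 0.
  by rewrite normr0 mul0r lip_norm_ge0//; exact: (lip_const_neq0 (0 *: f)).
rewrite mulrC -ler_pdivlMr ?normr_gt0// mulrC -normfV.
rewrite -[X in lip_norm a X <= _]scale1r -(mulVf c0) -scalerA.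
exact: lip_normZ_le.
Qed.

Lemma lip_norm0_eq0 (f : lip a) : lip_norm a f = 0 -> f = 0.
Proof.
move=> f0; apply/val_inj/funext => x /=; apply/normr0_eq0/eqP.
rewrite eq_le normr_ge0 andbT -f0.
rewrite (le_trans (sup_norm_ge x (lip_const_neq0 f)))// lerDl.
exact: lip_const_ge0 (lip_const_inf (lip_const_neq0 f)).
Qed.

HB.instance Definition _ := @Lmodule_isNormed.Build R (lip a)
  (fun f => lip_norm a f) lip_normD lip_normZ lip_norm0_eq0.

End lip_space.

Section ergodic_optimization.
Context (R : realType).
Implicit Type mu : probability (borel cantor_space) R.

Definition shift_invariant mu : Prop :=
  forall A : set (borel cantor_space), measurable A -> mu (shift @^-1` A) = mu A.

Definition periodic_measure mu : Prop :=
  exists (x : cantor_space) (p : nat), [/\ (0 < p)%N, iter p shift x = x &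
    mu [set iter k shift x | k in [set: nat]] = 1%E].

Definition maximizing (f : cantor_space -> R) mu : Prop :=
  shift_invariant mu /\
  (\int[mu]_x (f x)%:E = ereal_sup
     [set \int[nu]_x (f x)%:E | nu in [set nu | shift_invariant nu]])%E.

(* Two measures are identified when they agree on the measurable sets: their
   values elsewhere are irrelevant. *)
Definition unique_maximizing (f : cantor_space -> R) mu : Prop :=
  maximizing f mu /\
  forall nu : probability (borel cantor_space) R,
    maximizing f nu -> forall A : set (borel cantor_space), measurable A -> nu A = mu A.

Definition locking (a : scale R) : set (lip a) :=
  [set f : lip a | exists mu, [/\ unique_maximizing f mu, periodic_measure mu &
     \forall g \near f, unique_maximizing (g : lip a) mu]].

End ergodic_optimization.

(* Words are sequences of booleans, the letters 0 and 1 being [false] and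
   [true]; the words of length [n] are enumerated by [n.-tuple bool]. *)
Section haar.
Context (R : realType).

Definition cylinder (w : seq bool) : set cantor_space :=
  [set x | forall i, (i < size w)%N -> x i = nth false w i].

Definition haar (w : seq bool) (x : cantor_space) : R :=
  2^-1 * (\1_(cylinder (rcons w false)) x - \1_(cylinder (rcons w true)) x).

Definition haar_level (c : seq bool -> R) (n : nat) (x : cantor_space) : R :=
  \sum_(w : n.-tuple bool) c w * haar w x.

Definition haar_series (c : seq bool -> R) (g : cantor_space -> R) : Prop :=
  {uniform, (fun (N : nat) x => \sum_(0 <= n < N) haar_level c n x) @ \oo --> g}.

Record gauge := Gauge {
  gauge_val :> seq bool -> R ;
  gauge_gt0 : forall w, 0 < gauge_val w }.

(* The seed of both iterated operators is the value of [b] at one of the words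
   of length [n], hence does not affect the result. *)
Definition gauge_max (b : gauge) (n : nat) : R :=
  \big[Num.max/b (nseq n false)]_(w : n.-tuple bool) b w.

Definition gauge_min (b : gauge) (n : nat) : R :=
  \big[Num.min/b (nseq n false)]_(w : n.-tuple bool) b w.

Definition admissible (a : scale R) (b : gauge) : Prop :=
  (gauge_max b : nat -> R^o) =o_\oo (a : nat -> R^o) /\
  (fun n => ln (a n / gauge_min b n) : R^o) =O_\oo (fun n => n%:R : R^o).

Definition hilbert_brick (a : scale R) (b : gauge) : set (lip a) :=
  [set g | exists c : seq bool -> R,
     (forall w, `|c w| <= b w) /\ haar_series c g].

Lemma gauge_itv (b : gauge) w : - b w < b w.
Proof. by rewrite gtrN ?gauge_gt0. Qed.

(* The image, in the space [lip a], of the product of the uniform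
   probabilities on the intervals [- b w, b w] under the identification of the
   coefficients with the sum of the Haar series. It is characterized by its
   values on the images of the measurable rectangles with finitely many
   constrained coordinates [F], which form a pi-system generating the Borel
   sigma-algebra of the brick; with [F = [::]], the whole brick has measure 1. *)
Definition is_brick_measure (a : scale R) (b : gauge)
    (P : probability (borel (lip a)) R) : Prop :=
  forall (F : seq (seq bool)) (A : seq bool -> set R),
    uniq F -> (forall w, measurable (A w)) ->
    P [set g | exists c : seq bool -> R,
         [/\ forall w, `|c w| <= b w, haar_series c g &
             forall w, w \in F -> A w (c w)]] =
    (\prod_(w <- F) uniform_prob (gauge_itv b w) (A w))%E.

End haar.

(* Main.v *)
(* Approximate [f = f0 + g] by the function [W] of the first [n + 1] letters that
   keeps the Haar coefficients of [g] of level at most [n].  A walk in the de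
   Bruijn graph on the words of length [n] splits into closed walks of length at
   most [M = 2 ^ n], so that maximizing [W] is a maximum cycle mean problem.
   Suppose that the means of [W] along two periodic points of period at most [M]
   differ by at least [delta] as soon as the Haar averages of level [n] along
   them differ.  Then the best cycle is unique and simple, every passage outside
   it costs [delta], while passing from [W] to any function near [f] in the norm
   of [lip a] changes the Birkhoff sums by [O(M * a n.+1)] per such passage,
   because an orbit segment that stays in the cycle shadows the periodic orbit.
   Hence [f] is locking once [delta] is a large multiple of [M * a n.+1].
   For a pair of periodic points, some Haar coefficient of level [n] enters the
   difference of the means with a factor at least [1 / (2 M ^ 2)]; it is uniform
   on [- b w, b w], so that the gap fails with probability
   [O(M ^ 2 * delta / b w)].  There are [(M * 2 ^ M) ^ 2] pairs, and the
   evanescence of [a] makes the product of the two bounds tend to [0]. *)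

Require Import Defs.
From mathcomp Require Import all_boot all_order all_algebra.
From mathcomp Require Import all_classical all_reals all_analysis.
From mathcomp Require Import measurable_realfun.
From mathcomp Require Import zify ring lra.
Import Order.TTheory GRing.Theory Num.Theory.
Import numFieldNormedType.Exports.
(* MathComp-Analysis has a [shift] of its own. *)
Import Defs.

Local Open Scope classical_set_scope.
Local Open Scope ring_scope.

Set Implicit Arguments.
Unset Strict Implicit.
Unset Printing Implicit Defensive.

(** * Closed walks in the de Bruijn graph *)

Lemma iter_shift i (x : cantor_space) k : iter i shift x k = x (k + i)%N.
Proof. by elim: i k => [|i IHi] k; rewrite ?addn0//= /shift IHi addnS. Qed.

Definition agree (n : nat) (x y : cantor_space) : Prop :=
  forall k, (k < n)%N -> x k = y k.

Lemma agree_sym n x y : agree n x y -> agree n y x.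
Proof. by move=> xy k kn; rewrite xy. Qed.

Lemma agree_trans n y x z : agree n x y -> agree n y z -> agree n x z.
Proof. by move=> xy yz k kn; rewrite xy// yz. Qed.

Lemma agree_le m n x y : (m <= n)%N -> agree n x y -> agree m x y.
Proof. by move=> mn xy k km; apply: xy; exact: leq_trans km mn. Qed.

Lemma agree_iter n i x y :
  agree (n + i) x y -> agree n (iter i shift x) (iter i shift y).
Proof. by move=> xy k kn; rewrite !iter_shift xy// ltn_add2r. Qed.

Definition local_fun (R : realType) (n : nat) (W : cantor_space -> R) : Prop :=
  forall x y, agree n x y -> W x = W y.

Definition birkhoff (R : realType) (F : cantor_space -> R) (N : nat)
  (x : cantor_space) : R := \sum_(i < N) F (iter i shift x).

Definition repeat_word (q : nat) (x : cantor_space) : cantor_space :=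
  fun k => x (k %% q)%N.

(** Removes the letters at positions [i] to [i + q - 1], that is, excises from the walk a closed
    walk of length [q] that starts at time [i]. *)
Definition splice (i q : nat) (x : cantor_space) : cantor_space :=
  fun k => if (k < i)%N then x k else x (k + q)%N.

Section birkhoff_sums.
Context (R : realType).
Implicit Types (F G W : cantor_space -> R) (x y z : cantor_space).

Lemma birkhoffSr F N x :
  birkhoff F N.+1 x = birkhoff F N x + F (iter N shift x).
Proof. by rewrite /birkhoff big_ord_recr. Qed.

Lemma birkhoffD F m n x :
  birkhoff F (m + n) x = birkhoff F m x + birkhoff F n (iter m shift x).
Proof.
elim: n => [|n IHn]; first by rewrite addn0 /birkhoff big_ord0 addr0.
by rewrite addnS !birkhoffSr IHn addrA -iterD addnC.
Qed.

Lemma birkhoffM F p q x : iter p shift x = x ->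
  birkhoff F (q * p) x = q%:R * birkhoff F p x.
Proof.
move=> px; elim: q => [|q IHq]; first by rewrite /birkhoff big_ord0 mul0r.
by rewrite mulSn birkhoffD px IHq mulrSr mulrDl mul1r addrC.
Qed.

Lemma birkhoff_shift F p x : iter p shift x = x ->
  birkhoff F p (shift x) = birkhoff F p x.
Proof.
move=> px; have := birkhoffD F 1 p x; rewrite addnC birkhoffD px.
by rewrite addrC => /addrI.
Qed.

Lemma birkhoff_iter F p i x : iter p shift x = x ->
  birkhoff F p (iter i shift x) = birkhoff F p x.
Proof.
move=> px; elim: i => //= i IHi; rewrite birkhoff_shift ?IHi//.
by rewrite -iterD addnC iterD px.
Qed.

Lemma birkhoff_norm_le F B N x : (forall y, `|F y| <= B) ->
  `|birkhoff F N x| <= N%:R * B.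
Proof.
move=> FB; apply: le_trans (ler_norm_sum _ _ _) _.
rewrite mulr_natl -[X in _ *+ X](card_ord N) -sumr_const.
by apply: ler_sum => i _.
Qed.

Lemma birkhoff_agree n W N x y : local_fun n.+1 W -> agree (N + n) x y ->
  birkhoff W N x = birkhoff W N y.
Proof.
move=> Wn xy; apply: eq_bigr => i _; apply: Wn.
by apply: agree_iter; apply: agree_le xy; rewrite addSnnS addnC leq_add2r.
Qed.

Lemma agree_repeat_word n q x : (0 < q)%N -> agree n x (iter q shift x) ->
  agree (q + n) (repeat_word q x) x.
Proof.
move=> q0 xq k; rewrite /repeat_word; elim/ltn_ind: k => k IHk kq.
have [kltq|qk] := ltnP k q; first by rewrite modn_small.
have kqn : (k - q < n)%N by rewrite ltn_subLR.
rewrite -{2}(subnK qk) -(iter_shift q x) -xq// -(IHk (k - q)%N).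
- by rewrite -{1}(subnK qk) modnDr.
- by rewrite ltn_subrL q0 (leq_trans q0 qk).
- by rewrite (leq_trans kqn)// leq_addl.
Qed.

Lemma repeat_word_periodic q x :
  iter q shift (repeat_word q x) = repeat_word q x.
Proof. by apply/funext => k; rewrite iter_shift /repeat_word modnDr. Qed.

(** Indexes the periodic points of period at most [M] by a finite type, both for maximizing over
    them and for union bounds. The index [k] stands for the period [k.+1], which is thus
    positive. *)
Lemma repeat_word_bounded_period M q x : (0 < q <= M)%N ->
  exists (k : 'I_M) (s : M.-tuple bool),
    k.+1 = q /\ repeat_word q x = repeat_word k.+1 (nth false s).
Proof.
move=> /andP[q0 qM]; have qM' : (q.-1 < M)%N by rewrite prednK.
pose t := mktuple (fun i : 'I_M => x i).
exists (Ordinal qM'), t; split; rewrite /= ?prednK//.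
apply/funext => k; rewrite /repeat_word.
have kM : (k %% q < M)%N by rewrite (leq_trans _ qM)// ltn_mod.
by rewrite -(tnth_mktuple (fun i : 'I_M => x i) (Ordinal kM)) (tnth_nth false).
Qed.

(** Closed walks and periodic points carry the same sums: [W] reads only the first [q + n] letters
    during [q] steps, and on those [x] agrees with its periodic repetition. *)
Lemma closed_walk_sum n W q x : (0 < q)%N -> local_fun n.+1 W ->
  agree n x (iter q shift x) ->
  birkhoff W q (repeat_word q x) = birkhoff W q x.
Proof. by move=> q0 Wn xq; apply: birkhoff_agree Wn _; exact: agree_repeat_word. Qed.

(* Pigeonhole on the words of length [n] read at the times [0, ..., 2 ^ n]. *)
Lemma closed_walk_exists n x : exists i q,
  [/\ (0 < q)%N, (i + q <= 2 ^ n)%N &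
      agree n (iter i shift x) (iter (i + q) shift x)].
Proof.
pose f (i : 'I_(2 ^ n).+1) := [tuple x (k + i)%N | k < n].
have /injectivePn[i [j ij fij]] : ~~ injectiveb f.
  apply/negP => /injectiveP/leq_card.
  by rewrite card_ord card_tuple card_bool ltnn.
have key (k l : 'I_(2 ^ n).+1) : (k < l)%N -> f k = f l ->
    exists i q, [/\ (0 < q)%N, (i + q <= 2 ^ n)%N &
      agree n (iter i shift x) (iter (i + q) shift x)].
  move=> kl fkl; exists k, (l - k)%N; rewrite subn_gt0 (subnKC (ltnW kl)).
  split=> // [|m mn]; first by rewrite -ltnS.
  rewrite !iter_shift; have := congr1 (fun t => tnth t (Ordinal mn)) fkl.
  by rewrite !tnth_mktuple.
have := ij; rewrite -val_eqE neq_ltn => /orP[ltij|ltji]; first exact: key fij.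
exact: key (esym fij).
Qed.

(** Induction on the length of the walk: as long as it exceeds [2 ^ n], a closed walk of length at
    most [2 ^ n] can be excised, with mean at most [beta]. What remains in the end has at most
    [2 ^ n] steps, which the additive constant pays for. *)
Lemma walk_sum_le n W beta B : local_fun n.+1 W -> (forall x, `|W x| <= B) ->
  (forall q x, (0 < q <= 2 ^ n)%N -> agree n x (iter q shift x) ->
     birkhoff W q x <= q%:R * beta) ->
  forall N x, birkhoff W N x <= N%:R * beta + (2 ^ n)%:R * (B + `|beta|).
Proof.
move=> Wn WB cyc N; elim/ltn_ind: N => N IHN x.
have [NM|MN] := leqP N (2 ^ n).
  have B0 : 0 <= B by exact: le_trans (WB x).
  have S1 := le_trans (ler_norm _) (birkhoff_norm_le N x WB).
  have : N%:R * (B + `|beta|) <= (2 ^ n)%:R * (B + `|beta|).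
    by rewrite ler_wpM2r ?addr_ge0// ler_nat.
  have : N%:R * - `|beta| <= N%:R * beta.
    by rewrite ler_wpM2l// lerNl -normrN ler_norm.
  lra.
have [i [q [q0 iq xiq]]] := closed_walk_exists n x.
have qN : (i + q <= N)%N by exact: leq_trans iq (ltnW MN).
pose y := splice i q x.
(* Beyond position [i] the spliced point reads the letters [q] places later; since the excised walk
   is closed, the first [n] of them are unchanged. *)
have xy : agree (i + n) x y.
  move=> k kin; rewrite /y /splice; case: ltnP => // ik.
  have := xiq (k - i)%N; rewrite !iter_shift subnK// addnA subnK//.
  by apply; rewrite ltn_subLR.
have yx : iter i shift y = iter (i + q) shift x.
  by apply/funext => k; rewrite !iter_shift /y /splice ltnNge leq_addl /= addnA.
have xiq' : agree n (iter i shift x) (iter q shift (iter i shift x)).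
  by rewrite -iterD addnC.
have -> : birkhoff W N x = birkhoff W (N - q) y + birkhoff W q (iter i shift x).
  rewrite -[in LHS](subnKC qN) birkhoffD birkhoffD.
  have -> : (N - q)%N = (i + (N - (i + q)))%N by lia.
  by rewrite birkhoffD yx (birkhoff_agree Wn xy) -!addrA; congr +%R; rewrite addrC.
have := cyc q _ _ xiq'; rewrite q0 (leq_trans (leq_addl _ _) iq) => /(_ isT) Sq.
have := IHN (N - q)%N _ y; rewrite ltn_subrL q0 (leq_trans _ MN)// => /(_ isT).
rewrite natrB ?(leq_trans _ qN) ?leq_addl// => Sy.
by apply: le_trans (lerD Sy Sq) _; rewrite mulrBl; lra.
Qed.

End birkhoff_sums.

(** * Word frequencies along periodic orbits *)

Lemma mem_cylinder w x : (x \in cylinder w) = (mkseq x (size w) == w).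
Proof.
apply/idP/eqP; rewrite inE.
  move=> xw; apply: (@eq_from_nth _ false); rewrite size_mkseq// => i iw.
  by rewrite nth_mkseq// xw.
by move=> xw i iw; rewrite -xw nth_mkseq.
Qed.

Lemma mkseq_consl (x : cantor_space) n :
  mkseq x n.+1 = x 0%N :: mkseq (shift x) n.
Proof. by rewrite /mkseq /= -[1%N]addn0 iotaDl -map_comp. Qed.

Section word_frequencies.
Context (R : realType).
Implicit Types (x y z : cantor_space) (w : seq bool).

Lemma indic_cylinder_rcons w x :
  \1_(cylinder w) x =
  \1_(cylinder (rcons w false)) x + \1_(cylinder (rcons w true)) x :> R.
Proof.
rewrite !indicE !mem_cylinder !size_rcons !mkseqS !eqseq_rcons.
by case: (x (size w)); case: eqP; rewrite /= ?(addr0, add0r).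
Qed.

Lemma indic_cylinder_shift w x :
  \1_(cylinder w) (shift x) =
  \1_(cylinder (false :: w)) x + \1_(cylinder (true :: w)) x :> R.
Proof.
rewrite !indicE !mem_cylinder /= !mkseq_consl !eqseq_cons.
by case: (x 0%N); case: eqP; rewrite /= ?(addr0, add0r).
Qed.

Definition mean (F : cantor_space -> R) (p : nat) (x : cantor_space) : R :=
  birkhoff F p x / p%:R.

Lemma meanD F G p x : mean (fun y => F y + G y) p x = mean F p x + mean G p x.
Proof. by rewrite /mean /birkhoff big_split mulrDl. Qed.

Lemma meanZ c F p x : mean (fun y => c * F y) p x = c * mean F p x.
Proof. by rewrite /mean /birkhoff -mulr_sumr mulrA. Qed.

Lemma mean_sum (I : Type) (r : seq I) (F : I -> cantor_space -> R) p x :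
  mean (fun y => \sum_(i <- r) F i y) p x = \sum_(i <- r) mean (F i) p x.
Proof. by rewrite /mean /birkhoff exchange_big mulr_suml. Qed.

Lemma mean_shift F p x : iter p shift x = x ->
  mean (fun y => F (shift y)) p x = mean F p x.
Proof.
move=> px; rewrite /mean -(birkhoff_shift F px); congr (_ / _).
by apply: eq_bigr => i _; rewrite -iterSr.
Qed.

Lemma birkhoff_mean F p x : (0 < p)%N -> birkhoff F p x = p%:R * mean F p x.
Proof. by move=> p0; rewrite /mean mulrC divfK// pnatr_eq0 -lt0n. Qed.

(* If the Haar averages of level [n] agree, the difference [d] of the word
   frequencies satisfies [d (w b) = d w / 2] for words [w] of length [n], hence
   by invariance under the shift for shorter words too, and [d] vanishes on the
   empty word. *)
Lemma eq_haar_eq_freq n p x q y : (0 < p)%N -> (0 < q)%N ->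
  iter p shift x = x -> iter q shift y = y ->
  (forall w, size w = n -> mean (haar R w) p x = mean (haar R w) q y) ->
  forall w, (size w <= n.+1)%N ->
    mean \1_(cylinder w) p x = mean \1_(cylinder w) q y.
Proof.
move=> p0 q0 px qy xy.
pose d w := mean \1_(cylinder w) p x - mean \1_(cylinder w) q y.
have dr w : d w = d (rcons w false) + d (rcons w true).
  rewrite /d addrACA -opprD -!meanD.
  by congr (mean _ _ _ - mean _ _ _); apply/funext => z;
    exact: indic_cylinder_rcons.
have dl w : d w = d (false :: w) + d (true :: w).
  rewrite /d addrACA -opprD -!meanD -[in LHS](mean_shift _ px).
  rewrite -[X in _ - X = _](mean_shift _ qy).
  by congr (mean _ _ _ - mean _ _ _); apply/funext => z;
    exact: indic_cylinder_shift.
have dn w : size w = n -> d (rcons w false) = d (rcons w true).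
  move=> /xy; rewrite /haar !meanZ => /(mulfI _).
  rewrite invr_eq0 pnatr_eq0 => /(_ isT).
  have E u v r z : mean (fun t => \1_(cylinder u) t - \1_(cylinder v) t) r z =
      mean \1_(cylinder u) r z - mean \1_(cylinder v) r z :> R.
    rewrite -[- mean _ _ _]mulN1r -meanZ -meanD.
    by congr mean; apply/funext => t; rewrite mulN1r.
  by rewrite !E /d; lra.
have half k w b : (k <= n)%N -> size w = (n - k)%N -> d (rcons w b) = d w / 2.
  elim: k w b => [|k IHk] w b kn wk.
    have wn : size w = n by rewrite wk subn0.
    by have := dn _ wn; have := dr w; case: b; lra.
  rewrite dl -!rcons_cons !IHk ?(ltnW kn)//=; try (by rewrite wk; lia).
  by rewrite [in RHS]dl [RHS]mulrDl.
have mean_nil r z : (0 < r)%N -> mean \1_(cylinder [::]) r z = 1 :> R.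
  move=> r0; rewrite /mean /birkhoff (eq_bigr (fun=> 1)) => [|i _].
    by rewrite sumr_const card_ord divff// pnatr_eq0 -lt0n.
  by rewrite indicE mem_cylinder.
have d0 w : (size w <= n.+1)%N -> d w = 0.
  elim/last_ind: w => [_|w b IHw]; first by rewrite /d !mean_nil// subrr.
  rewrite size_rcons => wn; rewrite (half (n - size w)%N) ?leq_subr//.
    by rewrite IHw ?mul0r// ltnW.
  by rewrite subKn.
by move=> w wn; apply/eqP; rewrite -subr_eq0; apply/eqP; exact: d0.
Qed.

End word_frequencies.

(** * The maximal cycle *)

Lemma iter_shift_modn p i z : iter p shift z = z ->
  iter (i %% p) shift z = iter i shift z.
Proof.
move=> pz; rewrite [in RHS](divn_eq i p) addnC iterD; congr iter.
by elim: (i %/ p)%N => //= q IHq; rewrite mulSn iterD -IHq pz.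
Qed.

Lemma repeat_word_id q x : iter q shift x = x -> repeat_word q x = x.
Proof.
move=> qx; apply/funext => m.
by rewrite /repeat_word -[(m %% q)%N]add0n -iter_shift iter_shift_modn// iter_shift.
Qed.

Section maximal_cycles.
Context (R : realType).
Implicit Types (W : cantor_space -> R) (x y z : cantor_space).

(** Among the periodic points of period at most [2 ^ n] with the largest mean, take one of least
    period. If a word of length [n] occurred twice in a period, the cycle would split into two
    shorter closed walks; neither mean exceeds the maximum and their weighted average attains it, so
    a shorter period would attain it as well. *)
Lemma maximal_cycle n W : local_fun n.+1 W -> exists p z,
  [/\ (0 < p <= 2 ^ n)%N, iter p shift z = z,
      forall q x, (0 < q <= 2 ^ n)%N -> iter q shift x = x ->
        mean W q x <= mean W p z &
      forall i j, agree n (iter i shift z) (iter j shift z) -> i = j %[mod p]].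
Proof.
move=> Wn.
pose v (i : 'I_(2 ^ n) * (2 ^ n).-tuple bool) :=
  mean W i.1.+1 (repeat_word i.1.+1 (nth false i.2)).
have M0 : (0 < 2 ^ n)%N by rewrite expn_gt0.
pose i0 := (Ordinal M0, [tuple of nseq (2 ^ n) false]).
have [i _ imax] := @arg_maxP _ _ _ i0 predT v isT.
have vmax q x : (0 < q <= 2 ^ n)%N -> iter q shift x = x -> mean W q x <= v i.
  move=> q2n qx; have [k [s [kq xs]]] := repeat_word_bounded_period x q2n.
  by rewrite -(repeat_word_id qx) xs -kq; exact: (imax (k, s)).
pose P p := `[< (0 < p <= 2 ^ n)%N /\
  exists2 z, iter p shift z = z & mean W p z = v i >].
have exP : exists p, P p.
  exists i.1.+1; apply/asboolP; split; first by rewrite /= ltn_ord.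
  by exists (repeat_word i.1.+1 (nth false i.2)); first exact: repeat_word_periodic.
have [p /asboolP[p2n [z pz zv]] pmin] := ex_minnP exP.
have p0 : (0 < p)%N by case/andP: p2n.
exists p, z; split => // [q x|]; first by rewrite zv; exact: vmax.
suff key i1 i2 : (i1 < i2 < p)%N -> ~ agree n (iter i1 shift z) (iter i2 shift z).
  move=> i1 i2; rewrite -(iter_shift_modn i1 pz) -(iter_shift_modn i2 pz) => zi.
  have [lti|lti|//] := ltngtP (i1 %% p) (i2 %% p); exfalso.
    by apply: key zi; rewrite lti ltn_mod.
  by apply: key (agree_sym zi); rewrite lti ltn_mod.
move=> /andP[i12 i2p] zi; pose u := iter i1 shift z; pose q := (i2 - i1)%N.
have q0 : (0 < q)%N by rewrite subn_gt0.
have qp : (q < p)%N by rewrite (leq_ltn_trans (leq_subr _ _)).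
have qM : (0 < q <= 2 ^ n)%N.
  by rewrite q0 (leq_trans (ltnW qp))//; case/andP: p2n.
have uq : agree n u (iter q shift u) by rewrite -iterD subnK// ltnW.
have pu : iter (p - q) shift (iter q shift u) = u.
  by rewrite -iterD subnK ?(ltnW qp)// -iterD addnC iterD pz.
have pqM : (0 < p - q <= 2 ^ n)%N.
  by rewrite subn_gt0 qp (leq_trans (leq_subr _ _))//; case/andP: p2n.
have vle r x : (0 < r <= 2 ^ n)%N -> agree n x (iter r shift x) ->
    birkhoff W r x <= r%:R * v i.
  move=> rM xr; have r0 : (0 < r)%N by case/andP: rM.
  rewrite -(closed_walk_sum r0 Wn xr) birkhoff_mean// ler_wpM2l//.
  exact/vmax/repeat_word_periodic.
have S1 := vle _ _ qM uq.
have S2 : birkhoff W (p - q) (iter q shift u) <= (p - q)%:R * v i.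
  by apply: vle => //; rewrite pu; exact: agree_sym.
have S3 : birkhoff W p u = p%:R * v i.
  by rewrite (birkhoff_iter _ _ pz) birkhoff_mean// zv.
(* Two pieces bounded by the maximal mean add up to exactly that mean over [p] steps, so the first
   bound is an equality. *)
have S4 : birkhoff W q u = q%:R * v i.
  apply: le_anti; rewrite S1 /=.
  move: S3 S2; rewrite -[in birkhoff W p u](subnKC (ltnW qp)) birkhoffD.
  by rewrite (natrB _ (ltnW qp)) mulrBl; lra.
have : P q.
  apply/asboolP; split => //.
  exists (repeat_word q u); first exact: repeat_word_periodic.
  rewrite /mean (closed_walk_sum q0 Wn uq) S4 mulrAC divff ?mul1r//.
  by rewrite pnatr_eq0 -lt0n.
by move=> /pmin; rewrite leqNgt qp.
Qed.

(** The edges of the de Bruijn graph on words of length [n] are the words of length [n.+1]; this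
    tests whether the first edge of [x] lies outside the cycle of [z]. *)
Definition off_orbit n z x : bool :=
  `[< ~ exists i, agree n.+1 x (iter i shift z) >].

Lemma off_orbitPn n z x :
  reflect (exists i, agree n.+1 x (iter i shift z)) (~~ off_orbit n z x).
Proof. by rewrite /off_orbit asbool_neg negbK; exact: asboolP. Qed.

Lemma off_orbit_local n z x y : agree n.+1 x y ->
  off_orbit n z x = off_orbit n z y.
Proof.
move=> xy; apply/idP/idP; apply: contraTT => /off_orbitPn[i xi].
  by apply/off_orbitPn; exists i; exact: agree_trans xy xi.
by apply/off_orbitPn; exists i; exact: agree_trans (agree_sym xy) xi.
Qed.

(** The gap is asked only when some Haar average of level [n] differs: otherwise all words of length
    [n.+1] have the same frequencies along both orbits, and the two means of a function of [n.+1]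
    letters coincide. *)
Definition gap n W (delta : R) : Prop := forall p x q y,
  (0 < p <= 2 ^ n)%N -> (0 < q <= 2 ^ n)%N ->
  iter p shift x = x -> iter q shift y = y ->
  (exists2 w, size w = n & mean (haar R w) p x <> mean (haar R w) q y) ->
  delta <= `|mean W p x - mean W q y|.

(** With equal Haar averages, the word of length [n.+1] read where [x] leaves the cycle would have
    the same frequency along both orbits; it is positive along [x] and zero along [z]. *)
Lemma off_orbit_haar_neq n p z q x : (0 < p)%N -> (0 < q)%N ->
  iter p shift z = z -> iter q shift x = x ->
  (exists i, off_orbit n z (iter i shift x)) ->
  exists2 w, size w = n & mean (haar R w) q x <> mean (haar R w) p z.
Proof.
move=> p0 q0 pz qx [i]; rewrite -(iter_shift_modn i qx) => /asboolP xz.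
apply: contrapT => xzw; pose w := mkseq (iter (i %% q) shift x) n.+1.
have : mean \1_(cylinder w) q x = mean \1_(cylinder w) p z :> R.
  apply: (@eq_haar_eq_freq R n); rewrite ?size_mkseq// => u un.
  by apply: contrapT => ?; apply: xzw; exists u.
rewrite [in RHS]/mean [in RHS]/birkhoff big1 => [|j _].
  rewrite mul0r => /eqP; rewrite mulf_eq0 invr_eq0 pnatr_eq0 -[(q == 0)%N]negbK.
  rewrite -lt0n q0 orbF => /eqP S0; have iq : (i %% q < q)%N by rewrite ltn_mod.
  have S_ge0 (k : 'I_q) : true -> 0 <= \1_(cylinder w) (iter k shift x) :> R.
    by rewrite indicE ler0n.
  have /eqP := psumr_eq0P S_ge0 S0 (i := Ordinal iq) isT.
  by rewrite indicE mem_cylinder size_mkseq eqxx oner_eq0.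
rewrite indicE mem_cylinder size_mkseq.
have [/= E|//] := eqVneq (mkseq _ _) w; case: xz; exists j => k kn.
have := congr1 (fun s => nth false s k) E.
by rewrite /w !nth_mkseq.
Qed.

(** Apply the bound on walks to [W] plus a reward [delta] for each edge off the cycle. A periodic
    orbit with such an edge has mean at least [delta] below the maximum, which covers a reward of at
    most [delta] per step; any other periodic orbit earns no reward. *)
Lemma gap_walk_sum_le n W B delta : local_fun n.+1 W ->
  (forall x, `|W x| <= B) -> 0 < delta -> gap n W delta ->
  exists p z K, [/\ (0 < p <= 2 ^ n)%N, iter p shift z = z,
    forall i j, agree n (iter i shift z) (iter j shift z) -> i = j %[mod p] &
    forall N x, birkhoff W N x
        + delta * birkhoff (fun y => (off_orbit n z y)%:R) N x <=
      N%:R * mean W p z + K].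
Proof.
move=> Wn WB delta0 Wgap.
have [p [z [pM pz zmax zinj]]] := maximal_cycle Wn.
pose V x := W x + delta * (off_orbit n z x)%:R.
have Vn : local_fun n.+1 V.
  by move=> x y xy; rewrite /V (Wn _ _ xy) (off_orbit_local z xy).
have VB x : `|V x| <= B + delta.
  rewrite (le_trans (ler_normD _ _))// lerD// normrM gtr0_norm// ler_piMr ?(ltW delta0)//.
  by rewrite ger0_norm ?ler0n// lern1 leq_b1.
have SV N x : birkhoff V N x =
    birkhoff W N x + delta * birkhoff (fun y => (off_orbit n z y)%:R) N x.
  by rewrite /birkhoff big_split /= mulr_sumr.
have cyc q x : (0 < q <= 2 ^ n)%N -> agree n x (iter q shift x) ->
    birkhoff V q x <= q%:R * mean W p z.
  move=> qM xq; have [p0 q0] : (0 < p)%N /\ (0 < q)%N.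
    by case/andP: pM => ->; case/andP: qM => ->.
  rewrite -(closed_walk_sum q0 Vn xq); set y := repeat_word q x.
  have qy : iter q shift y = y by exact: repeat_word_periodic.
  have := zmax _ _ qM qy; rewrite SV birkhoff_mean// => yz.
  have [[i yi]|noff] := pselect (exists i, off_orbit n z (iter i shift y)).
    have := Wgap _ _ _ _ qM pM qy pz
      (off_orbit_haar_neq p0 q0 pz qy (ex_intro _ i yi)).
    rewrite ler0_norm ?subr_le0// opprB => dz.
    have le1 : birkhoff (fun t => (off_orbit n z t)%:R) q y <= q%:R * 1 :> R.
      apply: le_trans (ler_norm _) _; apply: birkhoff_norm_le => t.
      by rewrite ger0_norm ?ler0n// lern1 leq_b1.
    apply: (@le_trans _ _ (q%:R * mean W q y + delta * (q%:R * 1))).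
      by rewrite lerD2l ler_wpM2l// ltW.
    by rewrite mulr1 [delta * _]mulrC -mulrDr ler_wpM2l//; lra.
  rewrite [X in _ + _ * X](_ : _ = 0) ?mulr0 ?addr0 ?ler_wpM2l//.
  rewrite /birkhoff big1// => j _; case: (boolP (off_orbit _ _ _)) => // oj.
  by case: noff; exists j.
exists p, z, ((2 ^ n)%:R * (B + delta + `|mean W p z|)); split=> // N x.
by rewrite -SV; apply: walk_sum_le.
Qed.

End maximal_cycles.

(** * Shadowing of the maximal cycle *)

Section shadowing.
Context (R : realType) (n p : nat) (z : cantor_space).
Hypotheses (p_bound : (0 < p <= 2 ^ n)%N) (pz : iter p shift z = z).
Hypothesis z_inj : forall i j,
  agree n (iter i shift z) (iter j shift z) -> i = j %[mod p].

Lemma agree_orbit_eq i j : agree n (iter i shift z) (iter j shift z) ->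
  iter i shift z = iter j shift z.
Proof.
by move=> /z_inj ij; rewrite -(iter_shift_modn i pz) ij iter_shift_modn.
Qed.

(** The cycle is simple, so a word of length [n] determines the position on it. Consecutive edges on
    the cycle share such a word, hence sit at consecutive positions, and a stay of [t] edges follows
    one and the same point of the orbit. *)
Lemma orbit_shadow x t : (0 < t)%N ->
  (forall i, (i < t)%N -> ~~ off_orbit n z (iter i shift x)) ->
  exists s, agree (n + t) x (iter s shift z).
Proof.
case: t => // t _; elim: t => [|t IHt] good.
  by have /off_orbitPn[s xs] := good 0%N isT; exists s; rewrite addn1.
have [i it|s xs] := IHt _; first by apply: good; rewrite ltnW.
have /off_orbitPn[s' xs'] := good t.+1 (ltnSn _).
have E : iter t.+1 shift (iter s shift z) = iter s' shift z.
  rewrite -iterD; apply: agree_orbit_eq; rewrite iterD.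
  apply: agree_trans (agree_le (leqnSn n) xs').
  exact/agree_sym/agree_iter.
exists s => k; rewrite addnS ltnS leq_eqVlt => /predU1P[->|/xs//].
by rewrite -!(iter_shift t.+1) xs'// E.
Qed.

Lemma mean_norm_le (F : cantor_space -> R) rho q x : (0 < q)%N ->
  (forall y, `|F y| <= rho) -> `|mean F q x| <= rho.
Proof.
move=> q0 Frho; rewrite normrM normfV (ger0_norm (ler0n _ _)).
by rewrite ler_pdivrMr ?ltr0n// mulrC; exact: birkhoff_norm_le.
Qed.

(** Full turns contribute exactly the mean. The incomplete turn has fewer than [p] steps, hence at
    most [2 ^ n], and each exceeds the mean by at most [2 * rho]. *)
Lemma periodic_sum_le (F : cantor_space -> R) rho i t :
  (forall y, `|F y| <= rho) ->
  birkhoff F t (iter i shift z) <= t%:R * mean F p z + (2 ^ n)%:R * (2 * rho).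
Proof.
move=> Frho; have [p0 pn] := andP p_bound.
have pz' : iter p shift (iter i shift z) = iter i shift z.
  by rewrite -iterD addnC iterD pz.
rewrite {1}(divn_eq t p) birkhoffD birkhoffM// birkhoff_iter//.
have tE : t%:R = (t %/ p)%:R * p%:R + (t %% p)%:R :> R.
  by rewrite -natrM -natrD -divn_eq.
rewrite birkhoff_mean// tE.
have := le_trans (ler_norm _) (birkhoff_norm_le (t %% p)
  (iter (t %/ p * p) shift (iter i shift z)) Frho).
have rho0 : 0 <= rho by exact: le_trans (Frho z).
have tp : (t %% p)%:R <= (2 ^ n)%:R :> R.
  by rewrite ler_nat (leq_trans _ pn)// ltnW// ltn_mod.
have h1 : (t %% p)%:R * rho <= (2 ^ n)%:R * rho by rewrite ler_wpM2r.
have : (t %% p)%:R * - rho <= (t %% p)%:R * mean F p z.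
  by rewrite ler_wpM2l// lerNl (le_trans _ (mean_norm_le z p0 Frho))// -normrN ler_norm.
lra.
Qed.

Context (r : cantor_space -> R) (rho L A : R) (a : nat -> R).
Hypothesis r_rho : forall y, `|r y| <= rho.
Hypothesis r_lip : forall j x y, (n < j)%N -> agree j x y ->
  `|r x - r y| <= L * a j.
Hypotheses (L_ge0 : 0 <= L) (A_ge0 : 0 <= A).
Hypothesis a_sum : forall t, \sum_(j < t) a (n.+1 + j)%N <= A.

(** Bound for the excess over the mean during one stay on the cycle: an incomplete turn plus the
    total shadowing error. *)
Let D := (2 ^ n)%:R * (2 * rho) + L * A.

Lemma shadow_sum_le x t :
  (forall i, (i < t)%N -> ~~ off_orbit n z (iter i shift x)) ->
  birkhoff r t x <= t%:R * mean r p z + D.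
Proof.
have rho0 : 0 <= rho by exact: le_trans (r_rho z).
case: t => [_|t good].
  by rewrite /birkhoff big_ord0 mul0r add0r addr_ge0 ?mulr_ge0.
have [//|s xs] := orbit_shadow _ good.
rewrite -[leLHS](subrK (birkhoff r t.+1 (iter s shift z))) [leLHS]addrC /D [leRHS]addrA.
apply: lerD; first exact: periodic_sum_le.
(* Time is reversed: when [j] further steps remain, the point and its shadow still agree on
   [n.+1 + j] letters, so the errors sum to a tail of [a]. *)
rewrite -sumrB (reindex_inj rev_ord_inj) /=.
apply: le_trans (_ : L * \sum_(j < t.+1) a (n.+1 + j)%N <= _); last by rewrite ler_wpM2l.
rewrite mulr_sumr; apply: ler_sum => j _; apply: le_trans (ler_norm _) _.
apply: r_lip; first by rewrite addSn ltnS leq_addr.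
apply: agree_iter; apply: agree_le xs.
by have := ltn_ord j; lia.
Qed.

(** The edges off the cycle cut the walk into stays on the cycle. Each stay costs [D] and each
    cutting edge [2 * rho]; there is one more stay than there are cuts, whence the isolated [D]. The
    induction peels off the first cut. *)
Lemma remainder_sum_le N x :
  birkhoff r N x <= N%:R * mean r p z + D +
    (2 * rho + D) * birkhoff (fun y => (off_orbit n z y)%:R) N x.
Proof.
have rho0 : 0 <= rho by exact: le_trans (r_rho z).
have D0 : 0 <= D by rewrite addr_ge0 ?mulr_ge0.
have off_ge0 M y : 0 <= birkhoff (fun y => (off_orbit n z y)%:R) M y :> R.
  by rewrite sumr_ge0.
elim/ltn_ind: N x => N IHN x.
have [good|] := pselect (forall i, (i < N)%N -> ~~ off_orbit n z (iter i shift x)).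
  by apply: le_trans (shadow_sum_le good) _; rewrite lerDl mulr_ge0// addr_ge0// mulr_ge0.
move=> /existsNP bad.
have {}bad : exists i, (i < N)%N && off_orbit n z (iter i shift x).
  by have [i /not_implyP[iN /negP]] := bad; rewrite negbK; exists i; rewrite iN.
have [t /andP[tN ot] tmin] := ex_minnP bad.
have good i : (i < t)%N -> ~~ off_orbit n z (iter i shift x).
  move=> it; apply/negP => oi; have := tmin i.
  by rewrite oi (ltn_trans it tN) leqNgt it => /(_ isT).
have NE : N = (t + (1 + (N - t.+1)))%N by rewrite addnA addn1 subnKC.
have E F : birkhoff F N x = birkhoff F t x + F (iter t shift x) +
    birkhoff F (N - t.+1) (iter t.+1 shift x) :> R.
  rewrite [in LHS]NE birkhoffD birkhoffD addrA; congr (_ + _ + _).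
  by rewrite /birkhoff big_ord1.
have := IHN (N - t.+1)%N _ (iter t.+1 shift x).
rewrite ltn_subrL (leq_ltn_trans _ tN)// => /(_ isT) S1.
have S2 := shadow_sum_le good; have := r_rho (iter t shift x).
rewrite ler_norml => /andP[_ S3].
have := mean_norm_le z (proj1 (andP p_bound)) r_rho.
rewrite ler_norml => /andP[S4 _].
have NR : N%:R = t%:R + (1 + (N - t.+1)%:R) :> R by rewrite {1}NE !natrD.
rewrite !E ot /= NR.
have := mulr_ge0 (addr_ge0 (mulr_ge0 (ler0n _ 2) rho0) D0) (off_ge0 t x).
have arith (St F S' T N' m d bt b' : R) : S' <= N' * m + d + (2 * rho + d) * b' ->
    St <= T * m + d -> F <= rho -> - rho <= m -> 0 <= (2 * rho + d) * bt ->
    St + F + S' <= (T + (1 + N')) * m + d + (2 * rho + d) * (bt + 1 + b').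
  by move=> *; lra.
exact: arith.
Qed.

End shadowing.

Section birkhoff_gap.
Context (R : realType).

(** Writing [f] as [W] plus a remainder, each edge off the cycle loses [delta] through [W] and
    regains less through the remainder; [kappa] is the difference. The orbit of [z] depends on [W]
    alone and is chosen before [f], so that it serves a whole neighbourhood of functions. *)
Lemma birkhoff_gap n (W : cantor_space -> R) B (rho L A delta : R) (a : nat -> R) :
  local_fun n.+1 W -> (forall x, `|W x| <= B) -> gap n W delta ->
  0 <= L -> 0 <= A -> (forall t, \sum_(j < t) a (n.+1 + j)%N <= A) -> 0 <= rho ->
  2 * rho + ((2 ^ n)%:R * (2 * rho) + L * A) < delta ->
  exists p z, [/\ (0 < p)%N, iter p shift z = z,
    forall i j, agree n (iter i shift z) (iter j shift z) -> i = j %[mod p] &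
    forall f : cantor_space -> R, (forall x, `|f x - W x| <= rho) ->
      (forall j x y, (n < j)%N -> agree j x y -> `|f x - f y| <= L * a j) ->
      exists2 kappa : R, 0 < kappa & exists K, forall N x,
        birkhoff f N x + kappa * birkhoff (fun y => (off_orbit n z y)%:R) N x <=
          N%:R * mean f p z + K].
Proof.
move=> Wn WB Wgap L0 A0 aA rho0 lt_delta.
have delta0 : 0 < delta.
  by have := mulr_ge0 L0 A0; have := mulr_ge0 (ler0n R (2 ^ n)) rho0; lra.
have [p [z [K [pn pz z_inj SW]]]] := gap_walk_sum_le Wn WB delta0 Wgap.
have [p0 _] := andP pn; exists p, z; split => //.
move=> f fW f_lip; pose r x := f x - W x.
have r_lip j x y : (n < j)%N -> agree j x y -> `|r x - r y| <= L * a j.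
  move=> nj xy; rewrite /r (Wn _ _ (agree_le nj xy)) opprB addrA subrK.
  exact: f_lip.
have Sr := remainder_sum_le pn pz z_inj fW r_lip L0 A0 aA.
exists (delta - (2 * rho + ((2 ^ n)%:R * (2 * rho) + L * A))).
  by rewrite subr_gt0.
exists (K + ((2 ^ n)%:R * (2 * rho) + L * A)) => N x.
have fE : f = (fun y => W y + r y) by apply/funext => y; rewrite /r addrC subrK.
have SfE : birkhoff f N x = birkhoff W N x + birkhoff r N x.
  by rewrite {1}fE /birkhoff big_split.
have mfE : mean f p z = mean W p z + mean r p z by rewrite {1}fE meanD.
have := SW N x; have := Sr N x; rewrite SfE mfE -/(r _).
lra.
Qed.

End birkhoff_gap.

(** * Invariant measures *)

Lemma coord_continuous n : continuous (fun x : cantor_space => x n).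
Proof. exact: (@proj_continuous nat (fun=> bool) n). Qed.

Lemma agree_nbhs n (x : cantor_space) : nbhs x (agree n x).
Proof.
elim: n => [|n IHn]; first by apply: filterS filterT => y _ k.
have xn : nbhs x (fun y : cantor_space => y n = x n).
  exact: (@coord_continuous n x [set x n] (discrete_set1 (x n))).
apply: filterS2 IHn xn => y xy xyn k.
by rewrite ltnS leq_eqVlt => /predU1P[->|/xy//]; exact/esym.
Qed.

Lemma shift_continuous : continuous shift.
Proof.
move=> x; apply/cvg_sup => i.
apply: (@continuous_comp_initial cantor_space cantor_space bool (fun y => y i)).
exact: (@coord_continuous i.+1).
Qed.

Lemma open_borel (T : ptopologicalType) (U : set (borel T)) :
  (open : set (set T)) U -> measurable U.
Proof. exact: sub_sigma_algebra. Qed.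

Lemma shift_measurable :
  measurable_fun [set: borel cantor_space] (shift : borel cantor_space -> borel cantor_space).
Proof.
apply: (@measurability _ _ _ (borel cantor_space) _ _ (@open cantor_space)) => //.
move=> _ [U oU <-]; rewrite setTI; apply: open_borel.
by move/continuousP: shift_continuous; apply.
Qed.

Section borel_functions.
Context (R : realType).

Lemma uniform_local_measurable (f : cantor_space -> R) :
  (forall e, 0 < e -> exists n, forall x y, agree n x y -> `|f x - f y| < e) ->
  measurable_fun [set: borel cantor_space] f.
Proof.
move=> fe; have cf : continuous f.
  move=> x; apply/cvgrPdist_lt => e /fe[n fn].
  by apply: filterS (agree_nbhs n x) => y; exact: fn.
apply: (measurability _ (RGenOpens.measurableE R)).
move=> _ [_ [a [b ->] <-]]; rewrite setTI; apply: open_borel.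
by move/continuousP: cf; apply; exact: interval_open.
Qed.

Definition bounded_measurable (f : cantor_space -> R) : Prop :=
  measurable_fun [set: borel cantor_space] f /\ exists B, forall x, `|f x| <= B.

Lemma bounded_measurable_indic (A : set (borel cantor_space)) :
  measurable A -> bounded_measurable \1_A.
Proof.
move=> mA; split; first exact: measurable_indic.
by exists 1 => x; rewrite indicE ger0_norm ?ler0n// lern1 leq_b1.
Qed.

Lemma bounded_measurable_iter f i : bounded_measurable f ->
  bounded_measurable (fun x => f (iter i shift x)).
Proof.
move=> [mf [B fB]]; split; last by exists B.
have miter : measurable_fun [set: borel cantor_space]
    (iter i shift : borel cantor_space -> borel cantor_space).
  elim: i => [|i IHi]; first exact: measurable_id.
  exact: (measurableT_comp shift_measurable IHi).
exact: (measurableT_comp mf miter).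
Qed.

Lemma bounded_measurable_birkhoff f N : bounded_measurable f ->
  bounded_measurable (birkhoff f N).
Proof.
move=> bf; split; last first.
  by have [_ [B fB]] := bf; exists (N%:R * B) => x; exact: birkhoff_norm_le.
apply: measurable_sum => i; exact: (bounded_measurable_iter i bf).1.
Qed.

End borel_functions.

Section invariant_integrals.
Context (R : realType) (nu : probability (borel cantor_space) R).
Implicit Types f g : cantor_space -> R.

Lemma borel_prob_setT : nu [set: borel cantor_space] = 1%E.
Proof. exact: probability_setT. Qed.

Lemma bounded_measurable_integrable f : bounded_measurable f ->
  nu.-integrable [set: borel cantor_space] (EFin \o f).
Proof.
move=> [mf [B fB]]; apply: measurable_bounded_integrable => //.
  by apply: le_lt_trans (probability_le1 nu measurableT) _; rewrite ltry.
by exists B; split; [exact: num_real|move=> M BM x _; exact: le_trans (fB x) (ltW BM)].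
Qed.

Lemma integral_EFin_Rintegral f : bounded_measurable f ->
  (\int[nu]_x (f x)%:E)%E = (\int[nu]_x f x)%:E.
Proof.
move=> bf; rewrite /Rintegral fineK//.
exact: (integrable_fin_num measurableT (bounded_measurable_integrable bf)).
Qed.

Hypothesis nu_inv : shift_invariant nu.

Lemma Rintegral_shift f : bounded_measurable f ->
  \int[nu]_x f (shift x) = \int[nu]_x f x.
Proof.
move=> bf; rewrite /Rintegral; congr fine.
have mf : measurable_fun [set: borel cantor_space] (EFin \o f).
  by apply/measurable_EFinP; exact: bf.1.
have intf : nu.-integrable (shift @^-1` [set: borel cantor_space]) ((EFin \o f) \o shift).
  by rewrite preimage_setT; exact: bounded_measurable_integrable (bounded_measurable_iter 1 bf).
have := integral_pushforward shift_measurable mf intf measurableT.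
rewrite preimage_setT => <-; pose phi : {mfun borel cantor_space >-> borel cantor_space} :=
  MeasurableFun.Pack (MeasurableFun.Class
    (isMeasurableFun.Build _ _ _ _ _ shift_measurable)).
apply: (@eq_measure_integral _ _ R _ nu (pushforward nu phi)) => A mA _.
exact: nu_inv.
Qed.

Lemma Rintegral_birkhoff f N : bounded_measurable f ->
  \int[nu]_x birkhoff f N x = N%:R * \int[nu]_x f x.
Proof.
move=> bf; elim: N => [|N IHN].
  rewrite mul0r /Rintegral; under eq_integral do rewrite /birkhoff big_ord0.
  by rewrite integral0.
have iter_int M : \int[nu]_x f (iter M shift x) = \int[nu]_x f x.
  elim: M => // M <-; under eq_Rintegral do rewrite iterSr.
  exact/(@Rintegral_shift (fun x => f (iter M shift x)))/bounded_measurable_iter.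
under eq_Rintegral do rewrite birkhoffSr.
rewrite RintegralD//; last 2 first.
- exact/bounded_measurable_integrable/bounded_measurable_birkhoff.
- exact/bounded_measurable_integrable/bounded_measurable_iter.
by rewrite IHN iter_int -natr1 mulrDl mul1r.
Qed.

(** Integrating against an invariant measure multiplies the integrals by [N] while [K] stays fixed;
    an excess over [beta] would violate the inequality for large [N]. *)
Lemma Rintegral_gap f g kappa beta K : bounded_measurable f -> bounded_measurable g ->
  (forall N x, birkhoff f N x + kappa * birkhoff g N x <= N%:R * beta + K) ->
  \int[nu]_x f x + kappa * \int[nu]_x g x <= beta.
Proof.
move=> bf bg S_le; rewrite leNgt; apply/negP; rewrite -subr_gt0.
set e := _ - _ => e0.
have Ne_le N : N%:R * e <= K.
  have Sf := bounded_measurable_integrable (bounded_measurable_birkhoff N bf).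
  have Sg := bounded_measurable_integrable (bounded_measurable_birkhoff N bg).
  have : \int[nu]_x (birkhoff f N x + kappa * birkhoff g N x) <=
      \int[nu]_x (N%:R * beta + K).
    apply: le_Rintegral => //.
    - apply: (@integrableD _ _ _ nu _ measurableT (EFin \o birkhoff f N)
        (fun x => (kappa * birkhoff g N x)%:E)) => //.
      exact: (integrableZl measurableT kappa Sg).
    - exact: finite_measure_integrable_cst.
  rewrite Rintegral_cst//. rewrite [X in _ * fine X](_ : _ = 1%E) ?mulr1; last exact: borel_prob_setT.
  rewrite RintegralD//; last exact: (integrableZl measurableT kappa Sg).
  rewrite RintegralZl// !Rintegral_birkhoff// /e; lra.
have K0 : 0 <= K by have := Ne_le 0%N; rewrite mul0r.
have := archi_boundP (divr_ge0 K0 (ltW e0)); rewrite ltr_pdivrMr//.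
by rewrite ltNge Ne_le.
Qed.

Lemma Rintegral_indic (A : set (borel cantor_space)) : measurable A ->
  (\int[nu]_x \1_A x)%:E = nu A.
Proof.
move=> mA; rewrite -integral_EFin_Rintegral ?integral_indic ?setIT//.
exact: bounded_measurable_indic.
Qed.

(** The Birkhoff sum over one period is constant along the orbit, hence almost everywhere, and by
    invariance its integral is [p] times that of [f]. *)
Lemma Rintegral_periodic p z (O : set (borel cantor_space)) f : (0 < p)%N ->
  iter p shift z = z -> nu.-negligible (~` O) ->
  (forall x, O x -> exists s, x = iter s shift z) -> bounded_measurable f ->
  \int[nu]_x f x = mean f p z.
Proof.
move=> p0 pz nuO Oz bf; apply: (mulfI (_ : p%:R != 0)); first by rewrite pnatr_eq0 -lt0n.
rewrite -birkhoff_mean// -Rintegral_birkhoff// /Rintegral.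
have bS := bounded_measurable_birkhoff p bf.
rewrite (@ae_eq_integral _ _ _ nu _ (cst (birkhoff f p z)%:E))//.
- by rewrite integral_cst// [X in (_ * X)%E](_ : _ = 1%E) ?mule1//; exact: borel_prob_setT.
- by apply/measurable_EFinP; exact: bS.1.
- apply: negligibleS nuO => x /= fx Ox; apply: fx => _.
  by have [s ->] := Oz _ Ox; rewrite birkhoff_iter.
Qed.

End invariant_integrals.

Section orbit_measures.
Context (R : realType).

Lemma orbit_measure_exists p (z : cantor_space) : (0 < p)%N ->
  exists mu : probability (borel cantor_space) R,
    forall A : set (borel cantor_space), mu A = (mean \1_A p z)%:E.
Proof.
move=> p0; pose d := msum (fun i => (\d_(iter i shift z : borel cantor_space) :
  {measure set (borel cantor_space) -> \bar R})) p.
have dE A : d A = (birkhoff \1_A p z)%:E.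
  by rewrite /d /msum /birkhoff -sumEFin; apply: eq_bigr => i _; rewrite /= /dirac.
have dT : d [set: borel cantor_space] = p%:R%:E.
  rewrite dE /birkhoff (eq_bigr (fun=> 1)) => [|i _].
    by rewrite sumr_const card_ord.
  by rewrite indicE in_setT.
(* The total mass is [p], neither zero nor infinite, so the normalization divides by [p] and does
   not fall back on its default, the Dirac mass. *)
exists (mnormalize d (\d_(z : borel cantor_space))) => A.
have normE (m : \bar R) (P : set (borel cantor_space) -> \bar R) : m = p%:R%:E ->
    (if (m == 0%E) || (m == +oo%E) then fun U => P U
     else fun U => (d U * (fine m)^-1%:E)%E) A = (mean \1_A p z)%:E.
  move=> ->; rewrite ifF; first by rewrite dE -EFinM.
  by rewrite orbF eqe pnatr_eq0; apply/negbTE; rewrite -lt0n.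
exact: normE dT.
Qed.

(** Integrating the penalized inequality bounds the integral of [f] plus [kappa] times the mass of
    [E], the set of points whose first edge is off the cycle. The orbit measure attains the bound,
    so a maximizing measure gives [E] mass zero. By invariance almost no point ever leaves the
    cycle, and a point that never does lies on the orbit of [z]. *)
Lemma unique_maximizing_orbit n p z (f : cantor_space -> R) (kappa K : R)
    (mu : probability (borel cantor_space) R) :
  (0 < p)%N -> iter p shift z = z ->
  (forall i j, agree n (iter i shift z) (iter j shift z) -> i = j %[mod p]) ->
  bounded_measurable f -> 0 < kappa ->
  (forall N x, birkhoff f N x +
     kappa * birkhoff (fun y => (off_orbit n z y)%:R) N x <= N%:R * mean f p z + K) ->
  (forall A : set (borel cantor_space), mu A = (mean \1_A p z)%:E) ->
  unique_maximizing f mu.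
Proof.
move=> p0 pz z_inj bf kappa0 f_le muE.
pose E : set (borel cantor_space) := [set x | off_orbit n z x].
have E1 x : \1_E x = (off_orbit n z x)%:R :> R.
  by rewrite indicE; congr (nat_of_bool _)%:R; apply/idP/idP; rewrite inE.
have mE : measurable E.
  apply/(measurable_indicP R); rewrite (_ : \1_E = fun x => (off_orbit n z x)%:R).
    apply: uniform_local_measurable => e e0; exists n.+1 => x y xy.
    by rewrite (off_orbit_local z xy) subrr normr0.
  by apply/funext => x; exact: E1.
have bE : bounded_measurable (\1_E : cantor_space -> R).
  exact: bounded_measurable_indic.
have {}f_le N x : birkhoff f N x + kappa * birkhoff \1_E N x <= N%:R * mean f p z + K.
  rewrite (_ : birkhoff \1_E N x = birkhoff (fun y => (off_orbit n z y)%:R) N x).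
    exact: f_le.
  by apply: eq_bigr => i _; exact: E1.
pose O : set (borel cantor_space) := ~` \bigcup_i (iter i shift @^-1` E).
have Oz x : O x -> exists s, x = iter s shift z.
  move=> Ox; have good i : ~~ off_orbit n z (iter i shift x).
    by apply/negP => oi; apply: Ox; exists i.
  (* Shadowing for a longer time may yield another index [s'], but both points of the orbit share
     the first [n] letters of [x] and therefore coincide. *)
  have [s xs] := orbit_shadow pz z_inj (ltn0Sn 0) (fun i _ => good i).
  exists s; apply/funext => k.
  have [s' xs'] := orbit_shadow pz z_inj (ltn0Sn k) (fun i _ => good i).
  rewrite xs' ?addnS ?ltnS ?leq_addl//; congr (_ k).
  apply: (agree_orbit_eq pz z_inj); apply: agree_trans (agree_sym _) _.
    by apply: agree_le xs'; rewrite leq_addr.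
  by apply: agree_le xs; rewrite leq_addr.
have negO (nu : probability (borel cantor_space) R) : shift_invariant nu -> nu E = 0%E ->
    nu.-negligible (~` O).
  move=> nu_inv nuE; rewrite setCK; apply: negligible_bigcup => i.
  have miter k : measurable (iter k shift @^-1` E : set (borel cantor_space)).
    by apply/measurable_indicP; exact: (bounded_measurable_iter k bE).1.
  have nu0 k : nu (iter k shift @^-1` E) = 0%E.
    elim: k => // k IHk; rewrite -IHk -(nu_inv _ (miter k)); congr (nu _).
    by apply/seteqP; split => x; rewrite /preimage /= -iterSr.
  by apply/negligibleP => //; exact: nu0.
have mu_inv : shift_invariant mu.
  move=> A mA; rewrite !muE; congr EFin; rewrite -[RHS](mean_shift _ pz).
  by congr mean; apply/funext => x; rewrite !indicE.
have muE0 : mu E = 0%E.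
  rewrite muE; congr EFin; rewrite /mean /birkhoff big1 ?mul0r// => i _.
  by rewrite E1; have /off_orbitPn/negbTE -> : exists j,
    agree n.+1 (iter i shift z) (iter j shift z) by exists i.
have muf : (\int[mu]_x (f x)%:E)%E = (mean f p z)%:E.
  by rewrite integral_EFin_Rintegral//; congr EFin;
    exact: (Rintegral_periodic mu_inv p0 pz (negO _ mu_inv muE0)).
have nuf (nu : probability (borel cantor_space) R) : shift_invariant nu ->
    ((\int[nu]_x (f x)%:E) + kappa%:E * nu E <= (mean f p z)%:E)%E.
  move=> nu_inv; rewrite -Rintegral_indic// integral_EFin_Rintegral// -EFinM -EFinD.
  by rewrite lee_fin; exact: Rintegral_gap f_le.
have sup_f : ereal_sup [set (\int[nu]_x (f x)%:E)%E | nu in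
    [set nu : probability (borel cantor_space) R | shift_invariant nu]] = (mean f p z)%:E.
  apply/eqP; rewrite eq_le; apply/andP; split.
    apply: ge_ereal_sup => _ [nu nu_inv <-]; apply: le_trans (nuf _ nu_inv).
    by rewrite leeDl// mule_ge0// lee_fin ltW.
  by rewrite -muf; apply: ereal_sup_ubound; exists mu.
split; first by split; rewrite ?sup_f.
move=> nu [nu_inv]; rewrite sup_f => nu_max A mA.
have nuE : nu E = 0%E.
  have := nuf _ nu_inv; rewrite nu_max -Rintegral_indic// -EFinM -EFinD lee_fin.
  rewrite gerDl pmulr_rle0// => le0; congr EFin; apply: le_anti; rewrite le0 /=.
  by apply: Rintegral_ge0 => x _; rewrite indicE.
rewrite muE -Rintegral_indic//; congr EFin.
apply: (Rintegral_periodic nu_inv p0 pz (negO _ nu_inv nuE) Oz).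
exact: bounded_measurable_indic.
Qed.

End orbit_measures.

(** * Haar expansions *)

Section haar_expansions.
Context (R : realType).
Implicit Types (c : seq bool -> R) (x y : cantor_space) (F G : cantor_space -> R).

Definition haar_sign (e : bool) : R := if e then - 2^-1 else 2^-1.

Lemma haar_signE e : `|haar_sign e| = 2^-1.
Proof. by rewrite /haar_sign; case: e; rewrite ?normrN ger0_norm// invr_ge0. Qed.

Lemma haarE w x :
  haar R w x = if mkseq x (size w) == w then haar_sign (x (size w)) else 0.
Proof.
rewrite /haar !indicE !mem_cylinder !size_rcons !mkseqS !eqseq_rcons.
by case: eqP => _; rewrite /haar_sign; case: (x _); rewrite /= ?subrr ?mulr0//; lra.
Qed.

Lemma haar_levelE c n x :
  haar_level c n x = c (mkseq x n) * haar_sign (x n).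
Proof.
have sz : size (mkseq x n) == n by rewrite size_mkseq.
rewrite /haar_level (bigD1 (Tuple sz))//= haarE size_mkseq eqxx big1 ?addr0//.
move=> w wx; rewrite haarE size_tuple ifF ?mulr0//; apply/negbTE.
by apply: contraNneq wx => E; apply/eqP/val_inj; rewrite /= E.
Qed.

Definition haar_sum c N x : R := \sum_(0 <= n < N) haar_level c n x.

Lemma haar_sumS c N x : haar_sum c N.+1 x = haar_sum c N x + haar_level c N x.
Proof. by rewrite /haar_sum big_nat_recr. Qed.

Lemma agree_mkseq n x y : agree n x y -> mkseq x n = mkseq y n.
Proof.
by move=> xy; apply/eq_in_map => k; rewrite mem_iota => /andP[_]; exact: xy.
Qed.

Lemma haar_sum_local c N : local_fun N (haar_sum c N).
Proof.
move=> x y xy; apply: eq_big_nat => k /andP[_ kN].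
rewrite !haar_levelE (xy k kN) (agree_mkseq (n := k) (y := y))//.
exact: agree_le (ltnW kN) xy.
Qed.

Definition prepend (w : seq bool) : cantor_space := nth false w.

Lemma agree_prepend_rcons w e : agree (size w) (prepend (rcons w e)) (prepend w).
Proof. by move=> k kw; rewrite /prepend nth_rcons kw. Qed.

Lemma mkseq_prepend_rcons w e : mkseq (prepend (rcons w e)) (size w) = w.
Proof. by rewrite (agree_mkseq (@agree_prepend_rcons w e)) /prepend mkseq_nth. Qed.

(** Mean of [F] over the [2 ^ L] extensions of [w] by [L] letters, each completed by zeros: a finite
    substitute for the average over the cylinder of [w]. *)
Fixpoint avg (L : nat) F (w : seq bool) : R :=
  if L is L'.+1 then (avg L' F (rcons w false) + avg L' F (rcons w true)) / 2
  else F (prepend w).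

Lemma avg_dist L F G w (e : R) : (forall x, `|F x - G x| <= e) ->
  `|avg L F w - avg L G w| <= e.
Proof.
move=> FG; elim: L w => [|L IHL] w /=; first exact: FG.
have := IHL (rcons w false); have := IHL (rcons w true).
by rewrite !ler_norml => /andP[? ?] /andP[? ?]; apply/andP; split; lra.
Qed.

(** The two halves of a Haar function cancel in the average, so the levels from [size w] on
    disappear. *)
Lemma avg_haar_sum L c w :
  avg L (haar_sum c (size w + L)) w = haar_sum c (size w) (prepend w).
Proof.
elim: L w => [|L IHL] w /=; first by rewrite addn0.
have loc e := haar_sum_local c (@agree_prepend_rcons w e).
have lev e : haar_level c (size w) (prepend (rcons w e)) = c w * haar_sign e.
  rewrite haar_levelE mkseq_prepend_rcons; congr (_ * haar_sign _).
  by rewrite /prepend nth_rcons ltnn eqxx.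
have := IHL (rcons w false); have := IHL (rcons w true).
rewrite !size_rcons addSnnS => -> ->; rewrite !haar_sumS !lev !loc /haar_sign; lra.
Qed.

Definition coef (L : nat) F (w : seq bool) : R :=
  avg L F (rcons w false) - avg L F (rcons w true).

Lemma coef_haar_sum L c w : coef L (haar_sum c ((size w).+1 + L)) w = c w.
Proof.
have := avg_haar_sum L c (rcons w false); have := avg_haar_sum L c (rcons w true).
rewrite /coef !size_rcons => -> ->; rewrite !haar_sumS !haar_levelE.
rewrite !mkseq_prepend_rcons !(haar_sum_local c (@agree_prepend_rcons w _)).
by rewrite /prepend !nth_rcons ltnn eqxx /haar_sign; lra.
Qed.

Lemma haar_seriesP c F : haar_series c F <->
  forall e, 0 < e -> exists N0, forall N x, (N0 <= N)%N -> `|F x - haar_sum c N x| <= e.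
Proof.
split=> [cF e e0|cF P /uniform_nbhs[E [entE EP]]].
  have entE : entourage [set xy : R * R | ball xy.1 e xy.2] by exact: (entourage_ball R (PosNum e0)).
  have [|N0 _ N0e] := cF (fun G => forall y, setT y -> ball (F y) e (G y)).
    apply/uniform_nbhs; exists [set xy : R * R | ball xy.1 e xy.2].
    by split=> [|G GE y yT]; [exact: entE|exact: GE].
  by exists N0 => N x /N0e /(_ x I) /ltW.
have := entE; rewrite -entourage_ballE => -[e /= e0 eE].
have e20 : 0 < e / 2 by rewrite divr_gt0.
have [N0 N0e] := cF _ e20; exists N0 => // N N0N; apply: EP => x _; apply: eE => /=.
by rewrite /ball /= (le_lt_trans (N0e _ _ N0N))// ltr_pdivrMr// ltr_pMr// ltr1n.
Qed.

(** A coefficient is the difference of the averages over the two children of [w], and each average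
    moves by at most the uniform distance. Partial sums of a large common order replace [F] and
    [F']. *)
Lemma haar_series_coef_dist c c' F F' w (e : R) : haar_series c F ->
  haar_series c' F' -> (forall x, `|F x - F' x| <= e) -> `|c w - c' w| <= 2 * e.
Proof.
move=> /haar_seriesP cF /haar_seriesP cF' FF'.
apply/ler_addgt0Pr => d d0.
have d40 : 0 < d / 4 by rewrite divr_gt0.
have [N1 cF1] := cF _ d40; have [N2 cF2] := cF' _ d40.
pose L := (N1 + N2)%N; pose N := ((size w).+1 + L)%N.
have dN x : `|haar_sum c N x - haar_sum c' N x| <= e + d / 2.
  have N1N : (N1 <= N)%N by rewrite /N /L; lia.
  have N2N : (N2 <= N)%N by rewrite /N /L; lia.
  have := cF1 N x N1N; have := cF2 N x N2N; have := FF' x.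
  by rewrite !ler_norml => /andP[? ?] /andP[? ?] /andP[? ?]; apply/andP; split; lra.
rewrite -(coef_haar_sum L c w) -(coef_haar_sum L c' w) /coef.
have := avg_dist L (rcons w false) dN; have := avg_dist L (rcons w true) dN.
by rewrite !ler_norml => /andP[? ?] /andP[? ?]; apply/andP; split; lra.
Qed.

Lemma haar_sum_dist c c' N (e : R) x : (forall w, `|c w - c' w| <= e) ->
  `|haar_sum c N x - haar_sum c' N x| <= N%:R * e.
Proof.
move=> cc'; have e0 : 0 <= e by exact: le_trans (cc' [::]).
rewrite /haar_sum -sumrB (le_trans (ler_norm_sum _ _ _))//.
rewrite -[X in X%:R * _](subn0 N) mulr_natl -sumr_const_nat.
apply: ler_sum_nat => k _; rewrite !haar_levelE -mulrBl normrM haar_signE.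
by have := cc' (mkseq x k); lra.
Qed.

Lemma haar_sum_tail c (beta : nat -> R) N M x :
  (forall w, `|c w| <= beta (size w)) ->
  `|haar_sum c (N + M) x - haar_sum c N x| <= \sum_(k < M) beta (N + k)%N.
Proof.
move=> cb; elim: M => [|M IHM]; first by rewrite addn0 subrr normr0 big_ord0.
rewrite addnS haar_sumS big_ord_recr /= addrAC (le_trans (ler_normD _ _))// lerD//.
rewrite haar_levelE normrM haar_signE; have := cb (mkseq x (N + M)).
by rewrite size_mkseq; have := normr_ge0 (c (mkseq x (N + M))); lra.
Qed.

Lemma haar_series_tail c F (beta : nat -> R) N T x :
  (forall w, `|c w| <= beta (size w)) -> haar_series c F ->
  (forall M, \sum_(k < M) beta (N + k)%N <= T) -> `|F x - haar_sum c N x| <= T.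
Proof.
move=> cb /haar_seriesP cF bT; apply/ler_addgt0Pr => e /cF[N0 cN0].
have := cN0 (N + N0)%N x (leq_addl _ _).
have := le_trans (haar_sum_tail N N0 x cb) (bT N0).
by rewrite !ler_norml => /andP[? ?] /andP[? ?]; apply/andP; split; lra.
Qed.

End haar_expansions.

(** * Lipschitz functions and the locking property *)

Section lipschitz_space.
Context (R : realType) (a : scale R).

Lemma lip_le_norm (g : lip a) x : `|g x| <= `|g|.
Proof.
apply: le_trans (sup_norm_ge x (lip_const_neq0 g)) _.
by rewrite lerDl; exact: lip_const_ge0 (lip_const_inf (lip_const_neq0 g)).
Qed.

Lemma scale_le m n : (m <= n)%N -> a n <= a m.
Proof.
move=> /subnK <-; elim: (n - m)%N => // k IHk; rewrite addSn.
exact: le_trans (ltW (scale_decr _ _)) IHk.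
Qed.

Lemma dist_agree j x y : agree j x y -> dist a x y <= a j.
Proof.
move=> xy; rewrite /dist; case: pselect => [h|_]; last exact/ltW/scale_gt0.
case: ex_minnP => m xym _; apply: scale_le; rewrite leqNgt; apply/negP => mj.
by rewrite xy// eqxx in xym.
Qed.

Lemma lip_agree (g : lip a) j x y : agree j x y -> `|g x - g y| <= `|g| * a j.
Proof.
move=> xy; apply: le_trans (lip_const_inf (lip_const_neq0 g) x y) _.
apply: ler_pM; rewrite ?dist_ge0 ?dist_agree//.
  exact: lip_const_ge0 (lip_const_inf (lip_const_neq0 g)).
rewrite -[leLHS]add0r lerD2r.
exact: le_trans (sup_norm_ge point (lip_const_neq0 g)).
Qed.

Lemma scale_small (e : R) : 0 < e -> exists N, forall n, (N <= n)%N -> a n < e.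
Proof.
move=> e0; have /cvgrPdist_lt/(_ e e0)[N _ Ne] := scale_cvg0 a.
exists N => n /Ne; rewrite sub0r normrN; exact: le_lt_trans (ler_norm _).
Qed.

Lemma lip_bounded_measurable (g : lip a) : bounded_measurable g.
Proof.
split; last by exists `|g| => x; exact: lip_le_norm.
apply: uniform_local_measurable => e e0.
have g0 : 0 < `|g| + 1 by rewrite ltr_wpDl.
have [N Ne] := scale_small (divr_gt0 e0 g0); exists N => x y /(lip_agree g).
move=> /le_lt_trans; apply; have := Ne N (leqnn N); rewrite ltr_pdivlMr// mulrC.
by apply: le_lt_trans; rewrite ler_wpM2r ?lerDl// ltW// scale_gt0.
Qed.

Lemma lip_closed (S : set (lip a)) :
  (forall g, (forall e, 0 < e -> exists2 h, S h & `|g - h| < e) -> S g) -> closed S.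
Proof.
move=> Sg g clg; apply: Sg => e e0; have [h [Sh]] := clg _ (nbhsx_ballx g e e0).
by rewrite -ball_normE; exists h.
Qed.

Lemma lip_open (S : set (lip a)) :
  (forall g, S g -> exists2 e, 0 < e & forall h, `|g - h| < e -> S h) -> open S.
Proof.
move=> Sg; rewrite openE => g /Sg[e e0 geS]; by apply/nbhs_ballP; exists e.
Qed.

Lemma lockingP (f : lip a) : locking f <->
  exists2 mu : probability (borel cantor_space) R, periodic_measure mu &
    exists2 e, 0 < e & forall h : lip a, `|f - h| < e -> unique_maximizing h mu.
Proof.
split=> [[mu [_ pmu /nbhs_ballP[e /= e0 fe]]]|[mu pmu [e e0 fe]]].
  by exists mu => //; exists e => // h fh; apply: fe; rewrite -ball_normE.
exists mu; split=> //; first by apply: fe; rewrite subrr normr0.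
by apply/nbhs_ballP; exists e => //= h; rewrite -ball_normE; exact: fe.
Qed.

(** Serves to make the locking event Borel; half the locking radius is left for the perturbations of
    a nearby function. *)
Lemma locking_translate_open (f0 : lip a) : open [set g : lip a | locking (f0 + g)].
Proof.
apply: lip_open => g /lockingP[mu pmu [e e0 ge]]; exists (e / 2); first by rewrite divr_gt0.
move=> h gh; apply/lockingP; exists mu => //; exists (e / 2); first by rewrite divr_gt0.
move=> k hk; apply: ge; have := ler_normD (g - h) (f0 + h - k).
rewrite (_ : g - h + _ = f0 + g - k); first by lra.
by rewrite [f0 + h]addrC !addrA subrK [g + f0]addrC.
Qed.

End lipschitz_space.

(** * Closed subsets of the Hilbert brick *)

Section brick.
Context (R : realType) (a : scale R) (b : gauge R) (n0 : nat).
Hypothesis a_sum : forall N t, (n0 <= N)%N -> \sum_(j < t) a (N + j)%N <= 2 * a N.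
Hypothesis b_le : forall w, (n0 <= size w)%N -> b w <= a (size w).

(* Below [n0] the scale [a] does not control the coefficients. *)
Let beta (k : nat) : R := if (n0 <= k)%N then a k else gauge_max b k.

Lemma gauge_le_max w : b w <= gauge_max b (size w).
Proof. by rewrite /gauge_max -[w in b w]/(val (in_tuple w)) le_bigmax. Qed.

Lemma brick_tail (c : seq bool -> R) (F : cantor_space -> R) N x : (n0 <= N)%N ->
  (forall w, `|c w| <= b w) -> haar_series c F -> `|F x - haar_sum c N x| <= 2 * a N.
Proof.
move=> nN cb cF; have cbeta w : `|c w| <= beta (size w).
  by rewrite /beta; case: ifP => nw; apply: le_trans (cb w) _;
    [exact: b_le|exact: gauge_le_max].
apply: (haar_series_tail x cbeta cF) => M.
rewrite (eq_bigr (fun k : 'I_M => a (N + k)%N)) ?a_sum// => k _.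
by rewrite /beta ifT// (leq_trans nN)// leq_addr.
Qed.

(** Approximants of [g] from the set have coefficients that are Cauchy, because a coefficient is
    Lipschitz in the uniform norm. The limits stay in the closed sets [B w], and the tail bound
    common to the whole brick shows that their Haar series converges to [g]. *)
Lemma brick_closed (B : seq bool -> set R) :
  (forall w, closed (B w)) -> (forall w t, B w t -> `|t| <= b w) ->
  closed [set g : lip a | exists c, (forall w, B w (c w)) /\ haar_series c g].
Proof.
move=> Bcl Bb; apply: lip_closed => g gS.
pose e (j : nat) : R := j.+1%:R^-1.
have e0 j : 0 < e j by rewrite invr_gt0 ltr0n.
have /choice[ch chP] : forall j, exists ch : (seq bool -> R) * lip a,
    [/\ forall w, B w (ch.1 w), haar_series ch.1 ch.2 & forall x, `|g x - ch.2 x| <= e j].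
  move=> j; have [h [c [cB ch]] gh] := gS _ (e0 j); exists (c, h); split=> // x /=.
  exact: le_trans (lip_le_norm (g - h) x) (ltW gh).
pose u w j := (ch j).1 w.
have u_dist w i j : `|u w i - u w j| <= 2 * (e i + e j).
  have [_ si gi] := chP i; have [_ sj gj] := chP j.
  apply: haar_series_coef_dist si sj _ => x; have := gi x; have := gj x.
  by rewrite !ler_norml => /andP[? ?] /andP[? ?]; apply/andP; split; lra.
(* The limit of the coefficients is obtained as the supremum of the lower bounds that the
   approximations provide. *)
pose L w : set R := [set u w j - 2 * e j | j in setT].
have L_ub w j : ubound (L w) (u w j + 2 * e j).
  by move=> _ [i _ <-]; have := u_dist w i j; rewrite ler_norml => /andP[_]; lra.
have L_sup w : has_sup (L w).
  by split; [exists (u w 0%N - 2 * e 0%N), 0%N|exists (u w 0%N + 2 * e 0%N); exact: L_ub].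
pose c w := sup (L w).
have uc w j : `|u w j - c w| <= 2 * e j.
  have h1 : c w <= u w j + 2 * e j by apply: ge_sup (L_ub w j); case: (L_sup w).
  have h2 : u w j - 2 * e j <= c w by apply: sup_upper_bound (L_sup w) _ _; exists j.
  by rewrite ler_norml; apply/andP; split; lra.
have e_small d : 0 < d -> exists j, e j < d.
  move=> d0; have := archi_boundP (ltW (divr_gt0 ltr01 d0)).
  set k := Num.Def.archi_bound _ => kd; exists k; rewrite /e invf_plt ?posrE ?ltr0n//.
  by rewrite -div1r (lt_le_trans kd)// ler_nat.
have cB w : B w (c w).
  apply: Bcl => U [d /= d0 dU]; have d20 : 0 < d / 2 by rewrite divr_gt0.
  have [j ej] := e_small _ d20; exists (u w j); split; first by case: (chP j).
  apply: dU; rewrite /ball_ /= distrC; have := uc w j; lra.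
exists c; split=> //; apply/haar_seriesP => d d0.
have [N1 N1d] := scale_small a (divr_gt0 d0 (ltr0n R 2)).
exists (maxn n0 N1) => N x; rewrite geq_max => /andP[nN N1N].
apply/ler_addgt0Pr => d' d'0; have N0 : 0 < 1 + 2 * N%:R :> R by rewrite ltr_wpDr// mulr_ge0.
(* The approximant is chosen after [N]: its distance to [g] and the [N] coefficient errors total at
   most [(1 + 2 * N) * e j], which is below [d']. *)
have [j ej] := e_small _ (divr_gt0 d'0 N0); have [cBj sj gj] := chP j.
have cbj w : `|(ch j).1 w| <= b w by exact/Bb/cBj.
have := brick_tail x nN cbj sj; have := gj x; have := N1d N N1N.
have := haar_sum_dist N x (fun w => uc w j); move: ej; rewrite ltr_pdivlMr//.
rewrite !ler_norml => ? /andP[? ?] ? /andP[? ?] /andP[? ?]; apply/andP; split; lra.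
Qed.

End brick.

(** * Probability of a slab *)

Lemma subdivision_cell (R : realFieldType) (beta t : R) (K : nat) :
  0 < beta -> `|t| <= beta -> exists j : 'I_K.+1,
  - beta + j%:R * (2 * beta / K.+1%:R) <= t <=
  - beta + j%:R * (2 * beta / K.+1%:R) + 2 * beta / K.+1%:R.
Proof.
move=> beta0; rewrite ler_norml => /andP[t_ge t_le]; set h := 2 * beta / _.
have Kh : K.+1%:R * h = 2 * beta by rewrite /h mulrC divfK// pnatr_eq0.
have exj : exists j, t <= - beta + j%:R * h + h.
  by exists K; move: Kh; rewrite -natr1; lra.
have [j tj jmin] := ex_minnP exj.
have jK : (j < K.+1)%N by rewrite ltnS; apply: jmin; move: Kh; rewrite -natr1; lra.
exists (Ordinal jK); rewrite /= tj andbT.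
case: j jmin {tj jK} => [_|j jmin]; first by rewrite mul0r addr0.
rewrite leNgt; apply/negP => tj; have : (j < j)%N; last by rewrite ltnn.
by apply: jmin; move: tj; rewrite -natr1; lra.
Qed.

Lemma prodr_const_seq (R : comPzRingType) (I : Type) (s : seq I) (x : R) :
  \prod_(i <- s) x = x ^+ size s.
Proof. by elim: s => [|i s IHs]; rewrite ?big_nil ?big_cons ?IHs ?exprS. Qed.

Lemma uniform_prob_itv_le (R : realType) (u v s t : R) (uv : u < v) : s <= t ->
  (uniform_prob uv `[s, t]%classic <= ((t - s) / (v - u))%:E)%E.
Proof.
move=> st; rewrite /uniform_prob.
apply: (@le_trans _ _ (\int[lebesgue_measure]_(x in `[s, t]%classic) (cst (v - u)^-1%:E) x)%E).
  apply: ge0_le_integral => //.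
  - by move=> x _; rewrite lee_fin uniform_pdf_ge0.
  - by apply/measurable_EFinP/measurable_funTS; exact: measurable_uniform_pdf.
  - move=> x _; rewrite lee_fin /uniform_pdf; case: ifP => // _.
    by rewrite invr_ge0 subr_ge0 ltW.
rewrite integral_cst//= lebesgue_measure_itv/= lte_fin.
case: ltP => [_|ts]; first by rewrite -EFinD -EFinM lee_fin mulrC.
by rewrite mule0 lee_fin divr_ge0// subr_ge0// ltW.
Qed.

Lemma measure_bigsetU_le d (T : measurableType d) (R : realType)
    (P : probability T R) (I : Type) (s : seq I) (A : I -> set T) (x : R) :
  (forall i, measurable (A i)) -> (forall i, (P (A i) <= x%:E)%E) ->
  measurable (\big[setU/set0]_(i <- s) A i) /\
  (P (\big[setU/set0]_(i <- s) A i) <= ((size s)%:R * x)%:E)%E.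
Proof.
move=> mA PA; elim: s => [|i s [ms Ps]]; first by rewrite big_nil measure0 mul0r.
rewrite big_cons; split; first exact: measurableU.
apply: (le_trans (measureU2 P (mA i) ms)); apply: (le_trans (leeD (PA i) Ps)).
by rewrite -EFinD lee_fin /= -natr1 mulrDl mul1r addrC.
Qed.

Lemma prode_le (R : realType) (I : eqType) (s : seq I) (f : I -> \bar R) (r : I -> R) :
  (forall i, i \in s -> (0 <= f i <= (r i)%:E)%E) ->
  (0 <= \prod_(i <- s) f i <= (\prod_(i <- s) r i)%:E)%E.
Proof.
elim: s => [|i s IHs] fr; first by rewrite !big_nil lee01 lexx.
have /andP[f0 f1] := fr i (mem_head _ _).
have /andP[p0 p1] := IHs (fun j js => fr j (mem_behead (s := i :: s) js)).
by rewrite !big_cons mule_ge0//= EFinM lee_pmul.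
Qed.

Section slab.
Context (R : realType) (a : scale R) (b : gauge R) (n0 : nat).
Hypothesis a_sum : forall N t, (n0 <= N)%N -> \sum_(j < t) a (N + j)%N <= 2 * a N.
Hypothesis b_le : forall w, (n0 <= size w)%N -> b w <= a (size w).
Context (P : probability (borel (lip a)) R).
Hypothesis P_brick : is_brick_measure b P.

(** The set is closed, hence Borel, once the constraints are intersected with the intervals of the
    gauge; its measure is a product of uniform probabilities, each at most a ratio of lengths. *)
Lemma rectangle_prob (F : seq (seq bool)) (s t r : seq bool -> R) : uniq F ->
  (forall w, s w <= t w) -> (forall w, w \in F -> (t w - s w) / (b w - - b w) <= r w) ->
  let S := [set g : lip a | exists c, [/\ forall w, `|c w| <= b w, haar_series c g &
      forall w, w \in F -> s w <= c w <= t w]] in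
  measurable (S : set (borel (lip a))) /\ (P S <= (\prod_(w <- F) r w)%:E)%E.
Proof.
move=> uF st str S; pose A w : set R := `[s w, t w]%classic.
split.
  pose B w := `[- b w, b w]%classic `&` (if w \in F then A w else setT).
  rewrite (_ : S = [set g : lip a | exists c, (forall w, B w (c w)) /\ haar_series c g]).
    rewrite -[X in measurable X]setCK; apply: measurableC; apply: open_borel.
    apply: closed_openC; apply: (brick_closed a_sum b_le (B := B)) => [w|w u [+ _]].
      apply: closedI; first exact: interval_closed.
      by case: ifP => _; [exact: interval_closed|exact: closedT].
    by rewrite /= in_itv /= -ler_norml.
  apply/seteqP; split => g [c].
    move=> [cb cg cF]; exists c; split => // w; split => /=.
      by rewrite in_itv /= -ler_norml.
    by case: ifP => // /cF; rewrite /A /= in_itv.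
  move=> [cA cg]; exists c; split => // [w|w wF]; have [] := cA w.
    by rewrite /= in_itv /= -ler_norml.
  by rewrite wF /A /= in_itv.
have -> : S = [set g : lip a | exists c, [/\ forall w, `|c w| <= b w, haar_series c g &
    forall w, w \in F -> A w (c w)]].
  by apply/seteqP; split => g [c [cb cg cF]]; exists c; split => // w /cF;
    rewrite /A /= in_itv.
rewrite P_brick//; last by move=> w; exact: measurable_itv.
suff /andP[] : (0 <= \prod_(w <- F) uniform_prob (gauge_itv b w) (A w) <=
  (\prod_(w <- F) r w)%:E)%E by [].
apply: prode_le => w wF; rewrite measure_ge0 /=.
by apply: le_trans (uniform_prob_itv_le _ (st w)) _; rewrite lee_fin str.
Qed.

(* The coordinates other than [w0] are confined to the cells of a fine grid;
   each cell then confines [c w0] to an interval. *)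
Lemma slab_cover (F : seq (seq bool)) w0 (D : seq bool -> R) (t0 delta : R) :
  uniq (w0 :: F) -> D w0 != 0 -> 0 < delta ->
  exists U : set (borel (lip a)), [/\ measurable U,
    (P U <= (2 * delta / (`|D w0| * b w0))%:E)%E &
    forall c (g : lip a), (forall w, `|c w| <= b w) -> haar_series c g ->
      `|t0 + \sum_(w <- w0 :: F) c w * D w| <= delta -> U g].
Proof.
move=> /= /andP[w0F uF] D0 delta0; have nD0 : 0 < `|D w0| by rewrite normr_gt0.
pose V := \sum_(w <- F) `|D w| * (2 * b w).
have V0 : 0 <= V by apply: sumr_ge0 => w _; rewrite mulr_ge0// mulr_ge0// ltW// gauge_gt0.
(* The mesh is so fine that moving the coordinates in [F] within one cell changes the linear form by
   at most [delta]. *)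
have [K VK] : exists K, V / K.+1%:R <= delta.
  have := archi_boundP (divr_ge0 V0 (ltW delta0)); set K := Num.Def.archi_bound _ => VK.
  exists K; rewrite ler_pdivrMr ?ltr0n//; move: VK; rewrite ltr_pdivrMr// => VK.
  by rewrite -natr1 mulrDr mulr1; rewrite mulrC; nra.
pose h w := 2 * b w / K.+1%:R.
(* [q k] is the lower corner of the cell [k], and [s0 k] is the value of [c w0] that annihilates the
   form there. The half-width [eta] allows [delta] for the slab and [delta] for the cell. *)
pose q (k : (size F).-tuple 'I_K.+1) w := - b w + (nth ord0 k (index w F))%:R * h w.
pose s0 k := - (t0 + \sum_(w <- F) q k w * D w) / D w0.
pose eta := 2 * delta / `|D w0|.
have eta0 : 0 <= eta by rewrite divr_ge0 ?mulr_ge0 ?(ltW delta0).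
have h0 w : 0 <= h w by rewrite divr_ge0// mulr_ge0// ltW// gauge_gt0.
pose s k w := if w == w0 then s0 k - eta else q k w.
pose t k w := if w == w0 then s0 k + eta else q k w + h w.
have st k w : s k w <= t k w by rewrite /s /t; case: ifP => _; have := h0 w; lra.
pose r w := if w == w0 then 2 * delta / (`|D w0| * b w0) else K.+1%:R^-1.
have b2 w : b w - - b w != 0 by have := gauge_gt0 b w; rewrite opprK; apply: contraTneq; lra.
have str k w : w \in w0 :: F -> (t k w - s k w) / (b w - - b w) <= r w.
  move=> _; rewrite /s /t /r; have bw := gauge_gt0 b w.
  case: eqVneq => [->|_].
    rewrite le_eqVlt; apply/orP; left; apply/eqP; rewrite /eta; field.
    by rewrite b2 !gt_eqF ?gauge_gt0.
  rewrite le_eqVlt; apply/orP; left; apply/eqP; rewrite /h; field.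
  by rewrite b2 nat1r pnatr_eq0.
pose S k := [set g : lip a | exists c, [/\ forall w, `|c w| <= b w, haar_series c g &
  forall w, w \in w0 :: F -> s k w <= c w <= t k w]].
have uwF : uniq (w0 :: F) by rewrite /= w0F.
pose X := 2 * delta / (`|D w0| * b w0) * K.+1%:R^-1 ^+ size F.
have SX k : measurable (S k : set (borel (lip a))) /\ (P (S k) <= X%:E)%E.
  have := rectangle_prob uwF (st k) (str k); rewrite big_cons {1}/r eqxx.
  rewrite (_ : \prod_(w <- F) r w = K.+1%:R^-1 ^+ size F)//.
  rewrite -(prodr_const_seq F); apply: eq_big_seq => w wF.
  by rewrite /r ifF//; apply/negbTE; apply: contraNneq w0F => <-.
have [mU PU] := measure_bigsetU_le (enum {: (size F).-tuple 'I_K.+1})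
  (fun k => (SX k).1) (fun k => (SX k).2).
exists (\big[setU/set0]_(k <- enum {: (size F).-tuple 'I_K.+1}) S k); split => //.
  (* The number of cells cancels the factors [K.+1%:R^-1] in the probability of a cell. *)
  apply: le_trans PU _; rewrite lee_fin -cardE card_tuple card_ord /X natrX mulrCA -mulrA.
  by rewrite -exprMn divff ?pnatr_eq0// expr1n mulr1.
move=> c g cb cg c_slab.
have /choice[J JP] : forall w, exists j : 'I_K.+1,
    - b w + j%:R * h w <= c w <= - b w + j%:R * h w + h w.
  by move=> w; exact: subdivision_cell (gauge_gt0 b w) (cb w).
pose k := map_tuple J (in_tuple F).
have qJ w : w \in F -> q k w = - b w + (J w)%:R * h w.
  by move=> wF; rewrite /q /= (nth_map [::]) ?index_mem// nth_index.
have qc w : w \in F -> q k w <= c w <= q k w + h w by move=> wF; rewrite qJ.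
rewrite -bigcup_seq; exists k; first by rewrite /= mem_enum.
exists c; split => // w; rewrite inE /s /t; case: eqVneq => [->|_ /= wF]; last exact: qc.
move=> _; rewrite -ler_distl /s0 mulNr opprK.
rewrite -(ler_pM2r nD0) -normrM mulrDl divfK//.
have -> : eta * `|D w0| = 2 * delta by rewrite /eta divfK// gt_eqF.
have dist_le : `|\sum_(w <- F) q k w * D w - \sum_(w <- F) c w * D w| <= delta.
  apply: le_trans VK; rewrite -sumrB mulr_suml big_seq_cond [leRHS]big_seq_cond.
  apply: le_trans (ler_norm_sum _ _ _) _; apply: ler_sum => v /andP[vF _].
  rewrite -mulrBl normrM mulrC -mulrA ler_wpM2l// -/(h v).
  by have /andP[? ?] := qc v vF; rewrite ler_norml; apply/andP; split; have := h0 v; lra.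
move: c_slab dist_le; rewrite big_cons !ler_norml => /andP[? ?] /andP[? ?].
by apply/andP; split; lra.
Qed.

End slab.

(** * From a gap to the locking property *)

Section truncation.
Context (R : realType) (a : scale R) (b : gauge R) (n0 : nat).
Hypothesis a_sum : forall N t, (n0 <= N)%N -> \sum_(j < t) a (N + j)%N <= 2 * a N.
Hypothesis b_le : forall w, (n0 <= size w)%N -> b w <= a (size w).

(** The fixed function [f0] is sampled at the word completed by zeros, so that the means remain
    affine in the coefficients [c]. *)
Definition truncation (f0 : lip a) (c : seq bool -> R) n (x : cantor_space) : R :=
  f0 (prepend (mkseq x n)) + haar_sum c n x.

Lemma agree_prepend_mkseq n x : agree n (prepend (mkseq x n)) x.
Proof. by move=> k kn; rewrite /prepend nth_mkseq. Qed.

Lemma truncation_local f0 c n : local_fun n (truncation f0 c n).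
Proof.
by move=> x y xy; rewrite /truncation (agree_mkseq xy) (haar_sum_local c xy).
Qed.

(** Every function close to [f0 + g] is a small perturbation of the truncation, so all of them share
    the maximizing orbit that the gap singles out. *)
Lemma locking_of_gap (f0 g : lip a) c n : (n0 <= n)%N ->
  (forall w, `|c w| <= b w) -> haar_series c g ->
  gap n (truncation f0 c n.+1) ((6 * `|f0| + 23) * ((2 ^ n)%:R * a n.+1)) ->
  locking (f0 + g).
Proof.
move=> nn cb cg Wgap; set W := truncation f0 c n.+1 in Wgap.
have nn1 : (n0 <= n.+1)%N by exact: leqW.
have a1 : 0 < a n.+1 by exact: scale_gt0.
have Nf0 : 0 <= `|f0| by [].
(* In units of [a n.+1], [rho] counts the norm of [f0] for sampling it, 2 for the Haar tail of [g]
   and 1 for the perturbation. [L] counts the norm of [f0], 4 for the tails of [g] at two points and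
   1 for the perturbation. *)
pose f := f0 + g; pose rho := (`|f0| + 3) * a n.+1; pose L := `|f0| + 5.
have fW x : `|f x - W x| <= (`|f0| + 2) * a n.+1.
  have := lip_agree f0 (@agree_prepend_mkseq n.+1 x).
  have := brick_tail a_sum b_le x nn1 cb cg.
  rewrite (_ : f x = f0 x + g x)// /W /truncation !ler_norml.
  by move=> /andP[? ?] /andP[? ?]; apply/andP; split; lra.
have WB x : `|W x| <= `|f| + (`|f0| + 2) * a n.+1.
  have := fW x; have := lip_le_norm f x; rewrite !ler_norml.
  by move=> /andP[? ?] /andP[? ?]; apply/andP; split; lra.
have rho0 : 0 <= rho by rewrite mulr_ge0 ?(ltW a1)// addr_ge0.
have L0 : 0 <= L by rewrite addr_ge0.
have A0 : 0 <= 2 * a n.+1 by rewrite mulr_ge0// (ltW a1).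
(* After replacing [a n.+1] by the larger [2 ^ n * a n.+1], the left side is at most [6 * |f0| + 22]
   such units; the 23 makes the inequality strict. *)
have lt_gap : 2 * rho + ((2 ^ n)%:R * (2 * rho) + L * (2 * a n.+1)) <
    (6 * `|f0| + 23) * ((2 ^ n)%:R * a n.+1).
  have M1 : 1 <= (2 ^ n)%:R :> R by rewrite ler1n expn_gt0.
  have Ma : a n.+1 <= (2 ^ n)%:R * a n.+1 by rewrite ler_peMl// (ltW a1).
  have h1 : (4 * `|f0| + 16) * a n.+1 <= (4 * `|f0| + 16) * ((2 ^ n)%:R * a n.+1).
    by rewrite ler_wpM2l// addr_ge0// mulr_ge0.
  rewrite /rho /L; have h2 : 0 < (2 ^ n)%:R * a n.+1 by rewrite mulr_gt0// ltr0n expn_gt0.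
  lra.
have [p [z [p0 pz z_inj orb]]] := birkhoff_gap (@truncation_local f0 c n.+1) WB Wgap L0 A0
  (fun t => a_sum t nn1) rho0 lt_gap.
have [mu muE] := orbit_measure_exists R z p0.
apply/lockingP; exists mu.
  exists z, p; split => //; rewrite muE; congr EFin.
  rewrite /mean /birkhoff (eq_bigr (fun=> 1)) => [|i _].
    by rewrite sumr_const card_ord divff// pnatr_eq0 -lt0n.
  by rewrite indicE mem_set//; exists i.
exists (Num.min 1 (a n.+1)); first by rewrite lt_min ltr01.
move=> h; rewrite -/f lt_min => /andP[fh1 fha].
have [||kappa kappa0 [K hK]] := orb h.
- move=> x; have arith (u v w N e nh : R) : `|u - v| <= (N + 2) * e -> `|u - w| <= nh ->
      nh < e -> `|w - v| <= (N + 3) * e.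
    rewrite !ler_norml => /andP[? ?] /andP[? ?] ?; apply/andP; split; lra.
  exact: arith (fW x) (lip_le_norm (f - h) x) fha.
- move=> j x y nj xy; have nj0 : (n0 <= j)%N by exact: leq_trans nn (ltnW nj).
  have nh : `|f - h| * a j <= 1 * a j by rewrite ler_wpM2r// ltW// scale_gt0.
  have tx := brick_tail a_sum b_le x nj0 cb cg.
  have ty := brick_tail a_sum b_le y nj0 cb cg.
  rewrite (haar_sum_local c xy) in tx.
  have arith (u u' v v' w w' s N e r : R) : `|u - u'| <= N * e -> `|v - s| <= 2 * e ->
      `|v' - s| <= 2 * e -> `|(u + v - w) - (u' + v' - w')| <= r -> r <= 1 * e ->
      `|w - w'| <= (N + 5) * e.
    rewrite !ler_norml => /andP[? ?] /andP[? ?] /andP[? ?] /andP[? ?] ?.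
    by apply/andP; split; lra.
  exact: arith (lip_agree f0 xy) tx ty (lip_agree (f - h) xy) nh.
exact: (unique_maximizing_orbit p0 pz z_inj (lip_bounded_measurable h) kappa0 hK muE).
Qed.

End truncation.

(** * Probability of a small gap *)

Section mean_expansion.
Context (R : realType).

Definition short_words n : seq (seq bool) := [seq val t | t <- enum {: n.-bseq bool}].

Lemma short_words_uniq n : uniq (short_words n).
Proof. by rewrite map_inj_uniq ?enum_uniq//; exact: val_inj. Qed.

Lemma mem_short_words n w : (w \in short_words n) = (size w <= n)%N.
Proof.
apply/mapP/idP => [[t _ ->]|wn]; first exact: size_bseq.
by exists (Bseq wn); rewrite ?mem_enum.
Qed.

Lemma haar_sum_short_words (c : seq bool -> R) n x :
  haar_sum c n.+1 x = \sum_(w <- short_words n) c w * haar R w x.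
Proof.
rewrite big_map big_enum /= /haar_sum big_mkord.
rewrite [RHS](partition_big (fun t : n.-bseq bool => inord (size t) : 'I_n.+1) predT)//=.
apply: eq_bigr => m _.
have mn : (size (mkseq x m) <= n)%N by rewrite size_mkseq -ltnS.
have mE : inord (size (Bseq mn)) == m by rewrite /= size_mkseq inord_val.
rewrite (bigD1 (Bseq mn))//= big1 ?addr0 => [|t /andP[/eqP tm tx]].
  by rewrite haar_levelE haarE size_mkseq eqxx.
have tms : size t = m by rewrite -tm inordK// ltnS size_bseq.
rewrite haarE tms ifF ?mulr0//; apply/negbTE; apply: contraNneq tx => E.
by apply/eqP/val_inj; rewrite /= E.
Qed.

Lemma mean_haar_int w p x : exists k : int, mean (haar R w) p x = k%:~R / 2 / p%:R.
Proof.
suff [k kE] : exists k : int, birkhoff (haar R w) p x = k%:~R / 2.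
  by exists k; rewrite /mean kE.
elim: p => [|p [k kE]]; first by exists 0; rewrite /birkhoff big_ord0 mul0r.
rewrite birkhoffSr kE haarE /haar_sign; case: ifP => _; last first.
  by exists k; rewrite addr0.
case: (iter _ _ _ _); [exists (k - 1)|exists (k + 1)]; rewrite ?intrB ?intrD; lra.
Qed.

(** The means are integers divided by [2 * p] and [2 * q], so a nonzero difference is a nonzero
    integer over [2 * p * q]. *)
Lemma mean_haar_gap w p x q y M : (0 < p <= M)%N -> (0 < q <= M)%N ->
  mean (haar R w) p x != mean (haar R w) q y ->
  (2 * M%:R ^+ 2)^-1 <= `|mean (haar R w) p x - mean (haar R w) q y|.
Proof.
move=> /andP[p0 pM] /andP[q0 qM].
have [k ->] := mean_haar_int w p x; have [l ->] := mean_haar_int w q y => kl.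
have p0R : 0 < p%:R :> R by rewrite ltr0n.
have q0R : 0 < q%:R :> R by rewrite ltr0n.
have E : k%:~R / 2 / p%:R - l%:~R / 2 / q%:R =
    (k * q%:Z - l * p%:Z)%:~R / (2 * (p%:R * q%:R)) :> R.
  by rewrite intrB !intrM -!pmulrn; field; rewrite !gt_eqF.
have pq0 : 0 < 2 * (p%:R * q%:R) :> R by rewrite mulr_gt0// mulr_gt0.
rewrite E normrM -intr_norm normfV (gtr0_norm pq0).
have z0 : k * q%:Z - l * p%:Z != 0.
  apply: contraNneq kl => z0; rewrite -subr_eq0 E z0 mul0r; exact: eqxx.
apply: (@le_trans _ _ (1 / (2 * (p%:R * q%:R)))).
  have M0 : 0 < 2 * M%:R ^+ 2 :> R.
    by rewrite mulr_gt0// exprn_gt0// ltr0n (leq_trans p0).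
  rewrite div1r lef_pV2 ?posrE//.
  by rewrite ler_wpM2l// expr2 ler_pM ?ler_nat ?ltW.
rewrite ler_wpM2r ?invr_ge0 ?(ltW pq0)//.
by rewrite -[1]/(1%:~R) ler_int -gtz0_ge1 normr_gt0.
Qed.

Lemma mean_truncation (a : scale R) (f0 : lip a) c n p x :
  mean (truncation f0 c n.+1) p x =
  mean (fun y => f0 (prepend (mkseq y n.+1))) p x +
  \sum_(w <- short_words n) c w * mean (haar R w) p x.
Proof.
rewrite /truncation meanD; congr (_ + _).
rewrite (_ : haar_sum c n.+1 = fun y => \sum_(w <- short_words n) c w * haar R w y).
  by rewrite mean_sum; apply: eq_bigr => w _; rewrite meanZ.
by apply/funext => y; exact: haar_sum_short_words.
Qed.

End mean_expansion.

Section gap_probability.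
Context (R : realType) (a : scale R) (b : gauge R) (n0 : nat).
Hypothesis a_sum : forall N t, (n0 <= N)%N -> \sum_(j < t) a (N + j)%N <= 2 * a N.
Hypothesis b_le : forall w, (n0 <= size w)%N -> b w <= a (size w).
Context (P : probability (borel (lip a)) R).
Hypothesis P_brick : is_brick_measure b P.

Lemma gauge_min_gt0 n : 0 < gauge_min b n.
Proof.
by rewrite /gauge_min lt_bigmin// => [|w _]; exact: gauge_gt0.
Qed.

Lemma gauge_min_le w : gauge_min b (size w) <= b w.
Proof. by rewrite /gauge_min -[X in _ <= gauge_val b X]/(val (in_tuple w)) bigmin_le_cond. Qed.

(** Union bound over the pairs of periodic points: the difference of their means is affine in the
    coefficients, and some coefficient of level [n] has a factor at least [1 / (2 * M ^ 2)], so a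
    failure of the gap places the coefficients in a thin slab. *)
Lemma gap_cover (f0 : lip a) n (delta : R) : 0 < delta ->
  exists U : set (borel (lip a)), [/\ measurable U,
    (P U <= (((2 ^ n * 2 ^ 2 ^ n) ^ 2)%:R *
      (4 * (2 ^ n)%:R ^+ 2 * delta / gauge_min b n))%:E)%E &
    forall c (g : lip a), (forall w, `|c w| <= b w) -> haar_series c g -> ~ U g ->
      gap n (truncation f0 c n.+1) delta].
Proof.
move=> delta0; set M := (2 ^ n)%N; set X := 4 * _ * _ / _.
have X0 : 0 <= X.
  by rewrite divr_ge0 ?(ltW (gauge_min_gt0 n))// mulr_ge0 ?(ltW delta0)// mulr_ge0.
pose I : finType := ('I_M * M.-tuple bool)%type.
pose z (i : I) := repeat_word i.1.+1 (nth false i.2).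
have /choice[U UP] : forall ij : I * I, exists U : set (borel (lip a)),
    [/\ measurable U, (P U <= X%:E)%E & forall c (g : lip a),
      (forall w, `|c w| <= b w) -> haar_series c g ->
      (exists2 w, size w = n & mean (haar R w) ij.1.1.+1 (z ij.1) <>
                               mean (haar R w) ij.2.1.+1 (z ij.2)) ->
      `|mean (truncation f0 c n.+1) ij.1.1.+1 (z ij.1) -
        mean (truncation f0 c n.+1) ij.2.1.+1 (z ij.2)| <= delta -> U g].
  move=> [i j] /=; pose p := i.1.+1; pose q := j.1.+1.
  (* A pair with equal Haar averages is exempt from the gap condition and is covered by the empty
     set. *)
  have [[w0 w0n /eqP w0D]|same] := pselect (exists2 w, size w = n &
    mean (haar R w) p (z i) <> mean (haar R w) q (z j)); last first.
    by exists set0; split => [//||c g _ _ /same//]; rewrite measure0 lee_fin.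
  pose D w := mean (haar R w) p (z i) - mean (haar R w) q (z j).
  have w0S : w0 \in short_words n by rewrite mem_short_words w0n.
  have uS : uniq (w0 :: rem w0 (short_words n)).
    by rewrite /= rem_uniq ?short_words_uniq// mem_rem_uniq ?short_words_uniq// inE eqxx.
  have Dge : (2 * M%:R ^+ 2)^-1 <= `|D w0|.
    by apply: mean_haar_gap w0D; rewrite /= ltn_ord.
  have M0 : 0 < 2 * M%:R ^+ 2 :> R by rewrite mulr_gt0// exprn_gt0// ltr0n expn_gt0.
  have D0 : D w0 != 0 by rewrite subr_eq0.
  pose F := fun y => f0 (prepend (mkseq y n.+1)).
  have [U [mU PU UP]] := slab_cover a_sum b_le P_brick
    (mean F p (z i) - mean F q (z j)) uS D0 delta0.
  exists U; split => // [|c g cb cg _ le_delta].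
    apply: le_trans PU _; rewrite lee_fin /X.
    have gm := gauge_min_gt0 n; have gb := gauge_min_le w0; rewrite w0n in gb.
    have -> : 4 * M%:R ^+ 2 * delta / gauge_min b n =
        2 * delta / ((2 * M%:R ^+ 2)^-1 * gauge_min b n).
      by field; rewrite !gt_eqF//= ltr0n expn_gt0.
    rewrite ler_wpM2l ?mulr_ge0 ?(ltW delta0)// lef_pV2 ?posrE.
    - by rewrite ler_pM// ?invr_ge0 ltW.
    - by rewrite mulr_gt0// ?normr_gt0// gauge_gt0.
    - by rewrite mulr_gt0// invr_gt0.
  apply: UP cb cg _; apply: le_trans le_delta; rewrite le_eqVlt; apply/orP; left.
  apply/eqP; congr `| _ |; rewrite !mean_truncation -(perm_big _ (perm_to_rem w0S)) /=.
  rewrite /D; under eq_bigr do rewrite mulrBr.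
  by rewrite sumrB /F /p /q /=; lra.
have [mU PU] := measure_bigsetU_le (enum {: I * I})
  (fun ij => let: And3 h _ _ := UP ij in h) (fun ij => let: And3 _ h _ := UP ij in h).
exists (\big[setU/set0]_(ij <- enum {: I * I}) U ij); split => //.
  by apply: le_trans PU _; rewrite lee_fin -cardE !card_prod card_ord card_tuple card_bool mulnn.
move=> c g cb cg ngU p x q y pM qM px qy xy; rewrite leNgt; apply/negP => lt_delta.
have [k [s [kp xE]]] := repeat_word_bounded_period x pM.
have [l [t [lq yE]]] := repeat_word_bounded_period y qM.
rewrite (repeat_word_id px) in xE; rewrite (repeat_word_id qy) in yE.
subst p q; rewrite xE yE in xy lt_delta.
apply: ngU; rewrite -bigcup_seq; exists ((k, s), (l, t)); first by rewrite /= mem_enum.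
have [_ _ h] := UP ((k, s), (l, t)).
exact: h cb cg xy (ltW lt_delta).
Qed.

End gap_probability.

(** * Asymptotics of the scale and the gauge *)

Lemma mul_leq_pow2 d : exists N, forall n, (N <= n)%N -> (d * n <= 2 ^ n)%N.
Proof.
exists (6 * d).+2 => n nN; pose m := n./2.
have nE : n = (odd n + m.*2)%N by rewrite odd_double_half.
have mn : (n <= m.*2.+1)%N by case: (odd n) nE => ->; lia.
have md : (3 * d <= m)%N by lia.
have lt_m : (m < 2 ^ m)%N by exact: ltn_expl.
have m1 : (1 <= m)%N by lia.
have : (2 ^ (m + m) <= 2 ^ n)%N by rewrite leq_exp2l//; lia.
rewrite expnD; apply: leq_trans; apply: leq_trans (_ : m * m <= _)%N; last first.
  by apply: leq_mul; exact: ltnW.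
apply: leq_trans (_ : d * (3 * m) <= _)%N; first by rewrite leq_mul2l; lia.
by rewrite mulnCA mulnA leq_mul2r md orbT.
Qed.

Section asymptotics.
Context (R : realType) (a : scale R) (b : gauge R).

(** Comparison with a geometric series; the induction carries along the part [2 * a (N + t)] of the
    bound not yet spent. *)
Lemma scale_sum_le n0 : (forall k, (n0 <= k)%N -> a k.+1 <= a k / 2) ->
  forall N t, (n0 <= N)%N -> \sum_(j < t) a (N + j)%N <= 2 * a N.
Proof.
move=> a2 N t nN; suff : \sum_(j < t) a (N + j)%N + 2 * a (N + t)%N <= 2 * a N.
  by apply: le_trans; rewrite lerDl mulr_ge0// ltW// scale_gt0.
elim: t => [|t IHt]; first by rewrite big_ord0 addn0 add0r.
apply: le_trans IHt; rewrite big_ord_recr /= addnS.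
by have := a2 _ (leq_trans nN (leq_addr t N)); lra.
Qed.

Lemma evanescentP : evanescent a -> exists2 K, 0 < K & exists N, forall n, (N <= n)%N ->
  a n.+1 <= K * (2 ^+ (2 ^ n.+2))^-1 * a n.
Proof.
move=> /eqO_exP[K /= K0 [N _ NK]]; exists K => //; exists N => n /NK /=.
rewrite !ger0_norm ?invr_ge0 ?exprn_ge0//.
  by rewrite ler_pdivrMr// scale_gt0.
by rewrite divr_ge0// ltW// scale_gt0.
Qed.

(** Exponentiating the logarithmic bound gives a factor [expR K] per level, and [j] is such that
    [2 ^ j] exceeds it. *)
Lemma admissibleP : admissible a b -> exists N (j : nat), forall n, (N <= n)%N ->
  gauge_max b n <= a n /\ a n <= gauge_min b n * 2 ^+ (j * n).
Proof.
move=> [/eqoP bo /eqO_exP[K /= K0 [N1 _ aK]]].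
have [N2 _ bN] := bo 1 ltr01.
pose j := Num.Def.archi_bound (expR K).
exists (maxn N1 N2), j => n; rewrite geq_max => /andP[/aK /= an /bN /= bn]; split.
  by move: bn; rewrite mul1r (gtr0_norm (scale_gt0 a n)); exact: le_trans (ler_norm _).
have g0 := gauge_min_gt0 b n.
have eK : expR K <= 2 ^+ j.
  apply: le_trans (ltW (archi_boundP (expR_ge0 K))) _.
  by rewrite -natrX ler_nat ltnW// ltn_expl.
have q0 : 0 < a n / gauge_min b n by rewrite divr_gt0// scale_gt0.
rewrite mulrC -ler_pdivrMr// -(@lnK _ (_ / _)) ?posrE//.
apply: (@le_trans _ _ (expR (K * n%:R))).
  rewrite ler_expR (le_trans (ler_norm _))// (le_trans an)//.
  by rewrite (ger0_norm (ler0n _ n)).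
by rewrite mulrC expRM_natl exprM lerXn2r ?nnegrE ?expR_ge0 ?exprn_ge0.
Qed.

End asymptotics.

(** * Almost sure locking *)

Theorem theorem2 (R : realType) (a : scale R) (b : gauge R)
    (P : probability (borel (lip a)) R)
    (ha : evanescent a) (hb : admissible a b) (hP : is_brick_measure b P)
    (f0 : lip a) :
  P [set g | hilbert_brick b g /\ locking (f0 + g)] = 1%E.
Proof.
have [K K0 [N1 aN]] := evanescentP ha; have [N2 [j abN]] := admissibleP hb.
(* The failure probability will contain five factors [2 ^ n], namely two from the number of pairs,
   two from the slab and one from [delta], besides the factor [2 ^ (j * n)] from admissibility. *)
have [N3 jN] := mul_leq_pow2 (5 + j).
have [N4 KN] : exists N, forall n, (N <= n)%N -> K * (2 ^+ (2 ^ n.+2))^-1 <= 2^-1.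
  exists (Num.Def.archi_bound (2 * K)) => n Kn.
  rewrite ler_pdivrMr ?exprn_gt0// ler_pdivlMl//.
  have := archi_boundP (mulr_ge0 (ler0n R 2) (ltW K0)) => /ltW/le_trans; apply.
  rewrite -natrX ler_nat (leq_trans Kn)//.
  apply: leq_trans (ltnW (ltn_expl (2 ^ n.+2) (ltnSn 1))).
  by apply: leq_trans (ltnW (ltn_expl n.+2 (ltnSn 1))); rewrite !leqW.
pose n0 := (N1 + N2 + N3 + N4)%N.
have a_sum : forall N t, (n0 <= N)%N -> \sum_(j < t) a (N + j)%N <= 2 * a N.
  apply: scale_sum_le => k nk; have kN1 : (N1 <= k)%N by rewrite (leq_trans _ nk)// /n0; lia.
  have kN4 : (N4 <= k)%N by rewrite (leq_trans _ nk)// /n0; lia.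
  apply: le_trans (aN k kN1) _; rewrite mulrC; apply: ler_wpM2l (KN k kN4).
  exact/ltW/scale_gt0.
have b_le : forall w, (n0 <= size w)%N -> b w <= a (size w).
  move=> w nw; have wN2 : (N2 <= size w)%N by rewrite (leq_trans _ nw)// /n0; lia.
  exact: le_trans (gauge_le_max b w) (abN _ wN2).1.
pose Br : set (borel (lip a)) := hilbert_brick b.
pose Lk : set (borel (lip a)) := [set g : lip a | locking (f0 + g)].
(* The brick is the rectangle with no constrained coordinate. *)
have BrE : Br = [set g : lip a | exists c, [/\ forall w, `|c w| <= b w, haar_series c g &
    forall w, w \in [::] -> 0 <= c w <= 0]].
  by apply/seteqP; split => g [c]; [move=> [cb cg]|move=> [cb cg _]]; exists c.
have mBr : measurable Br.
  rewrite BrE; exact: (rectangle_prob a_sum b_le hP (F := [::]) (s := fun=> 0)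
    (t := fun=> 0) (r := fun=> 0) isT (fun=> lexx 0) (fun w wF => ltac:(by []))).1.
have PBr : P Br = 1%E.
  have := @hP [::] (fun=> setT) isT (fun=> measurableT); rewrite big_nil => <-.
  by congr (P _); apply/seteqP; split => g [c]; [move=> [cb cg]|move=> [cb cg _]]; exists c.
have mLk : measurable Lk by apply: open_borel; exact: locking_translate_open.
pose T := Br `\` Lk; have mT : measurable T by exact: measurableD.
pose C0 := 6 * `|f0| + 23; have C00 : 0 < C0 by rewrite ltr_wpDl// mulr_ge0.
have PT_le n : (n0 <= n)%N -> (P T <= (4 * C0 * K / (2 ^ n)%:R)%:E)%E.
  move=> nn; have nN1 : (N1 <= n)%N by rewrite (leq_trans _ nn)// /n0; lia.
  have nN2 : (N2 <= n)%N by rewrite (leq_trans _ nn)// /n0; lia.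
  have nN3 : (N3 <= n)%N by rewrite (leq_trans _ nn)// /n0; lia.
  have M0 : 0 < (2 ^ n)%:R :> R by rewrite ltr0n expn_gt0.
  have delta0 : 0 < C0 * ((2 ^ n)%:R * a n.+1) by rewrite mulr_gt0// mulr_gt0// scale_gt0.
  have [U [mU PU Ugap]] := gap_cover a_sum b_le hP f0 n delta0.
  have TU : T `<=` U.
    move=> g [[c [cb cg]] ng]; apply: contrapT => nU; apply: ng.
    by have := locking_of_gap a_sum b_le nn cb cg (Ugap c g cb cg nU).
  apply: (@le_trans _ _ (P U)); first by apply: le_measure; rewrite ?inE.
  apply: le_trans PU _; rewrite lee_fin.
  have gm := gauge_min_gt0 b n; have an := aN n nN1; have gn := (abN n nN2).2.
  have M5 : (2 ^ n)%:R ^+ 5 * 2 ^+ (j * n) <= (2 ^ 2 ^ n)%:R :> R.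
    by rewrite -natrX -natrX -natrM ler_nat -expnM [(n * 5)%N]mulnC -expnD -mulnDl leq_exp2l// jN.
  have E16 : (2 : R) ^+ (2 ^ n.+2) = (2 ^ 2 ^ n)%:R ^+ 4.
    by rewrite -!natrX -expnM; congr (_ ^ _)%:R; rewrite !expnS; lia.
  have MM : (2 ^ n)%:R <= (2 ^ 2 ^ n)%:R :> R by rewrite ler_nat ltnW// ltn_expl.
  have NE : ((2 ^ n * 2 ^ 2 ^ n) ^ 2)%:R = ((2 ^ n)%:R * (2 ^ 2 ^ n)%:R) ^+ 2 :> R.
    by rewrite [LHS]natrX natrM.
  move: M5 an E16 MM M0; rewrite NE {NE}.
  set M : R := (2 ^ n)%:R; set Q : R := (2 ^ 2 ^ n)%:R; set E := 2 ^+ (j * n).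
  move=> M5 an E16 MM M0; rewrite E16 in an.
  have Q0 : 0 < Q by exact: lt_le_trans MM.
  have : a n.+1 <= K * (Q ^+ 4)^-1 * (gauge_min b n * E).
    by apply: le_trans an _; rewrite ler_wpM2l// mulr_ge0 ?invr_ge0 ?exprn_ge0// ltW.
  move=> {}an; apply: (@le_trans _ _ ((M * Q) ^+ 2 * (4 * M ^+ 2 * (C0 * (M *
      (K * (Q ^+ 4)^-1 * (gauge_min b n * E)))) / gauge_min b n))).
    apply: ler_wpM2l; first by rewrite exprn_ge0// mulr_ge0// ltW.
    apply: ler_wpM2r; first by rewrite invr_ge0 ltW.
    apply: ler_wpM2l; first by rewrite mulr_ge0// exprn_ge0// ltW.
    by apply: ler_wpM2l; [exact: ltW|apply: ler_wpM2l => //; exact: ltW].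
  (* Evanescence supplies [Q ^ 4] in the denominator, with [Q] equal to 2 to the power [2 ^ n]. Two
     powers cancel against the number of pairs, one absorbs [M ^ 5 * E], and the last leaves at most
     [1 / M]. *)
  have -> : (M * Q) ^+ 2 * (4 * M ^+ 2 * (C0 * (M *
      (K * (Q ^+ 4)^-1 * (gauge_min b n * E)))) / gauge_min b n) =
      4 * C0 * K * (M ^+ 5 * E / Q ^+ 2).
    by field; rewrite !gt_eqF.
  rewrite ler_wpM2l ?mulr_ge0 ?(ltW C00) ?(ltW K0)//.
  rewrite ler_pdivrMr ?exprn_gt0// ler_pdivlMl//.
  by rewrite expr2; apply: ler_pM; rewrite ?(ltW M0)// mulr_ge0 ?exprn_ge0 ?(ltW M0).
(* The set [T] does not depend on [n], so the bounds for all large [n] apply to it at once. *)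
have PT0 : P T = 0%E.
  apply/eqP; rewrite eq_le measure_ge0 andbT; apply/lee_addgt0Pr => e e0.
  rewrite add0e; have C1 : 0 <= 4 * C0 * K by rewrite mulr_ge0 ?(ltW K0)// mulr_ge0// ltW.
  have := archi_boundP (divr_ge0 C1 (ltW e0)); set N := Num.Def.archi_bound _ => NC.
  apply: le_trans (PT_le (n0 + N)%N (leq_addr _ _)) _; rewrite lee_fin.
  have M0 : 0 < (2 ^ (n0 + N))%:R :> R by rewrite ltr0n expn_gt0.
  rewrite ler_pdivrMr// -ler_pdivrMl// mulrC (le_trans (ltW NC))// ler_nat.
  by rewrite (leq_trans (leq_addl n0 N))// ltnW// ltn_expl.
have le1 : (P (Br `&` Lk) <= 1)%E by apply: probability_le1; exact: measurableI.
rewrite -/(Br `&` Lk); apply/eqP; rewrite eq_le le1 /=.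
have BE : Br = (Br `&` Lk) `|` T.
  apply/seteqP; split => [g Bg|g [[]//|[]//]].
  by have [Lg|nLg] := pselect (Lk g); [left|right].
have : (P Br <= P (Br `&` Lk) + P T)%E.
  by rewrite {1}BE; exact: (measureU2 P (measurableI _ _ mBr mLk) mT).
by rewrite PBr PT0 adde0.
Qed.
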